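(* Let $p>2$ be a prime number such that $7\nmid p+4$ and $p\not\equiv 1\pmod 3$, and let $k$ be an algebraically closed field of characteristic $p$. Then the Jouanolou foliation of degree two, $\mathcal{J}_2$, on $\mathbb{P}^2_k$ has irreducible $p$-divisor (that is, $\mathcal{J}_2$ is not $p$-closed and $\Delta_{\mathcal{J}_2}$ is a prime divisor with multiplicity one).
   Context: Let $k$ be an algebraically closed field. A foliation $\mathcal{F}$ of degree $d$ on $\mathbb{P}^2_k$ is given, up to $k^*$, by a nonzero section $\omega\in H^0(\mathbb{P}^2_k,\Omega^1(d+2))$ with finite zero locus; equivalently $\omega=A\,dx+B\,dy+C\,dz$ on $\mathbb{A}^3_k$ with $A,B,C$ homogeneous of degree $d+1$, $xA+yB+zC=0$, and finitely many common zeros in $\mathbb{P}^2_k$. The Jouanolou foliation $\mathcal{J}_d$ of degree $d\ge 2$ is given by $\omega=(x^dz-y^{d+1})dx+(xy^d-z^{d+1})dy+(z^dy-x^{d+1})dz$; on $z=1$ it is defined by the vector field $(xy^d-1)\partial_x-(x^d-y^{d+1})\partial_y$. $p$-divisor ($\operatorname{char} k=p>0$): cover $\mathbb{P}^2_k$ by open sets $U_i$ on which $\mathcal{F}$ is defined by a $1$-form $\omega_i$ and a vector field $v_i$, both with isolated zeros, with $i_{v_i}\omega_i=0$. Let $v_i^p$ be the $p$-fold iterate of the derivation $v_i$ (again a vector field). $\mathcal{F}$ is $p$-closed if $i_{v_i^p}\omega_i=0$ for all $i$. Otherwise the functions $i_{v_i^p}\omega_i$ define an effective divisor $\Delta_{\mathcal{F}}$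 on $\mathbb{P}^2_k$, of degree $p(d-1)+d+2$, called the $p$-divisor of $\mathcal{F}$. *)

(* Defs.v *)
From mathcomp Require Import all_boot all_algebra.
From mathcomp Require Import mpoly ring.

Set Implicit Arguments.
Unset Strict Implicit.
Unset Printing Implicit Defensive.

Import GRing.Theory.
Local Open Scope ring_scope.

Section AffineSpace.

Variables (k : fieldType) (n : nat).
Implicit Types (v : 'I_n -> {mpoly k[n]}) (w : 'I_n -> {mpoly k[n]}).

(* [w : form1 k n] stands for \sum_i w i dx_i and [v : vfield k n] for
   \sum_i v i d/dx_i. *)
Definition form1 := 'I_n -> {mpoly k[n]}.
Definition vfield := 'I_n -> {mpoly k[n]}.

Definition derivation (v : vfield) (f : {mpoly k[n]}) : {mpoly k[n]} :=
  \sum_(i < n) v i * mderiv i f.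

Definition contraction (v : vfield) (w : form1) : {mpoly k[n]} :=
  \sum_(i < n) v i * w i.

(* The p-th iterate of the derivation v, given by its values on the
   coordinates; [derivation_vpow] justifies this in characteristic p. *)
Definition vpow (p : nat) (v : vfield) : vfield :=
  fun i => iter p (derivation v) 'X_i.

(* The coefficients of a form or of a vector field vanish simultaneously at
   only finitely many points of affine space. *)
Definition isolated_zeros (w : 'I_n -> {mpoly k[n]}) : Prop :=
  exists s : seq 'rV[k]_n,
    forall P : 'rV[k]_n, (forall i, (w i).@[P 0] = 0) -> P \in s.

Lemma derivationD v : {morph derivation v : f g / f + g}.
Proof.
move=> f g; rewrite /derivation -big_split /=.
by apply: eq_bigr => i _; rewrite mderivD mulrDr.
Qed.

Lemma derivation0 v : derivation v 0 = 0.
Proof. by rewrite /derivation big1 // => i _; rewrite mderiv0 mulr0. Qed.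

Lemma derivationMn v f m : derivation v (f *+ m) = derivation v f *+ m.
Proof.
by elim: m => [|m IH]; rewrite ?mulr0n ?derivation0 // !mulrS derivationD IH.
Qed.

Lemma derivationZ v c f : derivation v (c *: f) = c *: derivation v f.
Proof.
rewrite /derivation scaler_sumr; apply: eq_bigr => i _.
by rewrite mderivZ scalerAr.
Qed.

Lemma derivationM v f g :
  derivation v (f * g) = derivation v f * g + f * derivation v g.
Proof.
rewrite /derivation mulr_suml mulr_sumr -big_split /=.
apply: eq_bigr => i _.
by rewrite mderivM mulrDr !mulrA [f * v i]mulrC.
Qed.

Lemma derivation_sum v (I : Type) (r : seq I) (F : I -> {mpoly k[n]}) :
  derivation v (\sum_(i <- r) F i) = \sum_(i <- r) derivation v (F i).
Proof. exact: (big_morph _ (derivationD v) (derivation0 v)). Qed.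

Lemma derivationX v i : derivation v 'X_i = v i.
Proof.
rewrite /derivation (bigD1 i) //= big1 ?addr0 => [|j /negbTE nji].
  rewrite mderivX mnm1E eqxx scale1r.
  rewrite (_ : (U_(i) - U_(i))%MM = 0%MM) ?mpolyX0 ?mulr1 //.
  by apply/mnmP => j; rewrite mnmBE subnn mnm0E.
by rewrite mderivX mnm1E eq_sym nji scale0r mulr0.
Qed.

Lemma derivation1 v : derivation v 1 = 0.
Proof. by rewrite /derivation big1 // => i _; rewrite -mpolyC1 mderivC mulr0. Qed.

Lemma iter_derivationM v m f g :
  iter m (derivation v) (f * g) =
  \sum_(i < m.+1)
     (iter (m - i) (derivation v) f * iter i (derivation v) g) *+ 'C(m, i).
Proof.
pose a i j := iter i (derivation v) f * iter j (derivation v) g.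
elim: m => [|m IH]; first by rewrite big_ord1 /= bin0.
rewrite iterS IH derivation_sum.
transitivity (\sum_(i < m.+1) a (m - i).+1 i *+ 'C(m, i) +
              \sum_(i < m.+1) a (m - i)%N i.+1 *+ 'C(m, i)).
  rewrite -big_split /=; apply: eq_bigr => i _.
  by rewrite derivationMn derivationM mulrnDl.
rewrite [RHS]big_ord_recl [in LHS]big_ord_recl !bin0 !subn0 -addrA.
congr (_ + _).
transitivity (\sum_(i < m.+1) a (m - i)%N i.+1 *+ 'C(m, i.+1) +
              \sum_(i < m.+1) a (m - i)%N i.+1 *+ 'C(m, i)).
  congr (_ + _); rewrite [RHS]big_ord_recr /= bin_small // mulr0n addr0.
  by apply: eq_bigr => i _; rewrite /bump /= add1n subnSK.
rewrite -big_split /=; apply: eq_bigr => i _.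
by rewrite -mulrnDr /bump /= add1n binS subSS.
Qed.

Lemma derivation_vpow (p : nat) v (f : {mpoly k[n]}) :
  p \in [pchar k] -> derivation (vpow p v) f = iter p (derivation v) f.
Proof.
move=> chp; have p_pr := pcharf_prime chp.
have itD a b : iter p (derivation v) (a + b) =
    iter p (derivation v) a + iter p (derivation v) b.
  by elim: p {chp p_pr} => //= m ->; rewrite derivationD.
have itZ c a : iter p (derivation v) (c *: a) = c *: iter p (derivation v) a.
  by elim: p {chp p_pr itD} => //= m ->; rewrite derivationZ.
have itM a b : iter p (derivation v) (a * b) =
    iter p (derivation v) a * b + a * iter p (derivation v) b.
  case: p chp p_pr {itD itZ} => // q chp q_pr.
  rewrite iter_derivationM big_ord_recl subn0 bin0 mulr1n; congr (_ + _).
  rewrite big_ord_recr big1 => [|i _].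
    by rewrite /= add0r /bump /= add1n subnn binn mulr1n.
  have /dvdnP[e ->] : (q.+1 %| 'C(q.+1, lift ord0 (widen_ord (leqnSn q) i)))%N.
    by apply: prime_dvd_bin => //; rewrite /= /bump /= add1n ltnS ltn_ord.
  by rewrite mulrnA -(@scaler_nat k) (pcharf0 chp) scale0r.
have it1 : iter p (derivation v) 1 = 0.
  have := itM 1 1; rewrite !(mul1r, mulr1) => /eqP.
  by rewrite -subr_eq subrr eq_sym => /eqP.
elim/mpolyind: f => [|c m f _ _ IH].
  by have := itZ 0 0; rewrite !scale0r derivation0.
rewrite derivationD derivationZ itD itZ IH; congr (_ *: _ + _).
rewrite mpolyXE_id.
apply: (big_ind (fun f => derivation (vpow p v) f = iter p (derivation v) f)).
- by rewrite derivation1 it1.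
- by move=> a b ha hb; rewrite derivationM itM ha hb.
move=> i _; elim: (m i) => [|e IHe]; first by rewrite expr0 derivation1 it1.
by rewrite exprS derivationM itM IHe derivationX.
Qed.

End AffineSpace.

Record foliation (k : fieldType) (d : nat) := Foliation {
  fol_form :> form1 k 3;
  fol_neq0 : exists i, fol_form i != 0;
  fol_homog : forall i, fol_form i \is d.+1.-homog;
  fol_euler : \sum_(i < 3) 'X_i * fol_form i = 0;
  fol_zeros : exists s : seq 'rV[k]_3,
    forall P : 'rV[k]_3, P != 0 -> (forall i, (fol_form i).@[P 0] = 0) ->
    exists2 Q, Q \in s & exists2 c : k, c != 0 & P = c *: Q }.

Section Charts.

Variable k : fieldType.

(* Dehomogenization x_i = 1 on the chart U_i = {x_i != 0}, identified with the
   affine plane; the coordinate number j of the chart is x_(lift i j) / x_i. *)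
Definition dehomog (i : 'I_3) (f : {mpoly k[3]}) : {mpoly k[2]} :=
  f \mPo [tuple if unlift i j is Some l then 'X_l else 1 | j < 3].

(* Restriction of a 1-form: the differential of x_i = 1 vanishes. *)
Definition chart_form (i : 'I_3) (w : form1 k 3) : form1 k 2 :=
  fun j => dehomog i (w (lift i j)).

(* A 1-form and a vector field defining the foliation on the chart U_i, whose
   invertible functions are the nonzero constants. *)
Record local_model d (F : foliation k d) (i : 'I_3) := LocalModel {
  lm_form : form1 k 2;
  lm_vfield : vfield k 2;
  lm_restr : exists2 c : k, c != 0 &
    forall j, lm_form j = c *: chart_form i F j;
  lm_form_zeros : isolated_zeros lm_form;
  lm_vfield_zeros : isolated_zeros lm_vfield;
  lm_contraction : contraction lm_vfield lm_form = 0 }.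

(* a du + b dv is annihilated by b d/du - a d/dv. *)
Definition dual_vfield (w : form1 k 2) : vfield k 2 :=
  fun j => if j == 0 then w 1 else - w 0.

Lemma contraction_dual w : contraction (dual_vfield w) w = 0.
Proof.
rewrite /contraction !big_ord_recl big_ord0 addr0 /dual_vfield /=.
rewrite (_ : lift ord0 ord0 = 1 :> 'I_2); last exact/val_inj.
by rewrite (_ : ord0 = 0 :> 'I_2) // mulNr [X in X - _]mulrC subrr.
Qed.

Lemma dual_vfield_zeros w :
  isolated_zeros w -> isolated_zeros (dual_vfield w).
Proof.
case=> s sP; exists s => P zP; apply: sP.
have w1 : (w 1).@[P 0] = 0 by have := zP 0.
have w0 : (w 0).@[P 0] = 0.
  by have := zP 1; rewrite /dual_vfield /= mevalN => /eqP; rewrite oppr_eq0 => /eqP.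
case=> [[|[|j]] lt_j] //.
  by rewrite (_ : Ordinal lt_j = 0) //; apply/val_inj.
by rewrite (_ : Ordinal lt_j = 1) //; apply/val_inj.
Qed.

Lemma meval_dehomog (i : 'I_3) f (P : 'rV[k]_2) :
  (dehomog i f).@[P 0] =
  f.@[(\row_j (if unlift i j is Some l then P 0 l else 1)) 0].
Proof.
rewrite /dehomog comp_mpoly_meval; apply: meval_eq => j.
rewrite tnth_mktuple mxE; case: unliftP => [l _|_]; first exact: mevalXU.
exact: meval1.
Qed.

Lemma chart_form_zeros d (F : foliation k d) i :
  isolated_zeros (chart_form i F).
Proof.
have [s sP] := fol_zeros F.
exists [seq \row_l (Q 0 (lift i l) / Q 0 i) | Q : 'rV[k]_3 <- s] => P zP.
pose R : 'rV[k]_3 := \row_j (if unlift i j is Some l then P 0 l else 1).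
have Ri : R 0 i = 1 by rewrite mxE unlift_none.
have Rl l : R 0 (lift i l) = P 0 l by rewrite mxE liftK.
have zl l : (fol_form F (lift i l)).@[R 0] = 0 by rewrite -(zP l) /chart_form meval_dehomog.
have zi : (fol_form F i).@[R 0] = 0.
  have /(congr1 (meval (R 0))) := fol_euler F.
  rewrite meval0 raddf_sum /= (bigD1 i) //= big1 => [|j].
    by rewrite addr0 mevalM mevalXU Ri mul1r.
  by rewrite eq_sym => /unlift_some [l -> _]; rewrite mevalM zl mulr0.
have zR j : (fol_form F j).@[R 0] = 0 by case: (unliftP i j) => [l ->|->].
have nR : R != 0.
  by apply/eqP => R0; move/eqP: Ri; rewrite R0 mxE eq_sym oner_eq0.
have [Q Qs [c c0 RQ]] := sP R nR zR.
apply/mapP; exists Q => //; apply/rowP => l; rewrite mxE -Rl.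
have cQ : c * Q 0 i = 1 by rewrite -Ri RQ mxE.
have Q0 : Q 0 i != 0.
  by apply/eqP => Q0; move/eqP: cQ; rewrite Q0 mulr0 eq_sym oner_eq0.
by rewrite RQ mxE (canRL (mulfK Q0) cQ) mul1r mulrC.
Qed.

Lemma chart_form_restr d (F : foliation k d) i :
  exists2 c : k, c != 0 & forall j, chart_form i F j = c *: chart_form i F j.
Proof. by exists 1; [exact: oner_neq0 | move=> j; rewrite scale1r]. Qed.

Definition std_model d (F : foliation k d) (i : 'I_3) : local_model F i :=
  LocalModel (chart_form_restr F i) (chart_form_zeros F i)
    (dual_vfield_zeros (chart_form_zeros F i)) (contraction_dual _).

(* Local equations on the three standard charts; two systems define the same
   divisor when they agree up to units, see [same_divisor]. *)
Definition divisor_eqs := 'I_3 -> {mpoly k[2]}.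

Definition same_divisor (D E : divisor_eqs) : Prop :=
  forall i, exists2 c : k, c != 0 & D i = c *: E i.

Definition curve (f : {mpoly k[3]}) : divisor_eqs := fun i => dehomog i f.

Definition irreducible_mpoly n (f : {mpoly k[n]}) : Prop :=
  [/\ f != 0, f \isn't a GRing.unit &
      forall g h, f = g * h -> g \is a GRing.unit \/ h \is a GRing.unit].

(* Prime divisors of the projective plane, taken with multiplicity one, are the
   divisors of irreducible homogeneous polynomials. *)
Definition prime_divisor (D : divisor_eqs) : Prop :=
  exists e (f : {mpoly k[3]}),
    [/\ f \is e.-homog, irreducible_mpoly f & same_divisor D (curve f)].

Section PDivisor.

Variables (p d : nat) (F : foliation k d).

Definition p_divisor : divisor_eqs := fun i =>
  contraction (vpow p (lm_vfield (std_model F i))) (lm_form (std_model F i)).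

Definition p_closed : Prop := forall i, p_divisor i = 0.

End PDivisor.

End Charts.

Section Jouanolou.

Variables (k : closedFieldType) (d : nat).

Let x : {mpoly k[3]} := 'X_0.
Let y : {mpoly k[3]} := 'X_1.
Let z : {mpoly k[3]} := 'X_2%R.

Definition jouanolou_form : form1 k 3 := fun i =>
  [:: x ^+ d * z - y ^+ d.+1; x * y ^+ d - z ^+ d.+1; z ^+ d * y - x ^+ d.+1]`_i.

Let meval_xyz (P : 'rV[k]_3) :
  (x.@[P 0] = P 0 0) * (y.@[P 0] = P 0 1) * (z.@[P 0] = P 0 2%R).
Proof. by rewrite !mevalXU. Qed.

Lemma jouanolou_neq0 : exists i, jouanolou_form i != 0.
Proof.
exists 2%R; apply/eqP => /(congr1 (meval ((delta_mx 0 0 : 'rV[k]_3) 0))).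
rewrite /= mevalB !mevalM !rmorphXn /= !meval_xyz meval0 !mxE /=.
by rewrite mulr0 expr1n add0r => /eqP; rewrite oppr_eq0 oner_eq0.
Qed.

Lemma jouanolou_homog i : jouanolou_form i \is d.+1.-homog.
Proof.
have hX (j : 'I_3) : ('X_j : {mpoly k[3]}) \is 1.-homog by rewrite dhomogX /= mdeg1.
have hXn (j : 'I_3) m : ('X_j ^+ m : {mpoly k[3]}) \is m.-homog.
  by have := dhomogMn m (hX j); rewrite mul1n.
case: i => [[|[|[|j]]] lt_i] //; rewrite /jouanolou_form /=.
- by rewrite rpredB ?hXn // -(addn1 d); exact: dhomogM (hXn _ _) (hX _).
- by rewrite rpredB ?hXn // -(add1n d); exact: dhomogM (hX _) (hXn _ _).
by rewrite rpredB ?hXn // -(addn1 d); exact: dhomogM (hXn _ _) (hX _).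
Qed.

Lemma jouanolou_euler : \sum_(i < 3) 'X_i * jouanolou_form i = 0.
Proof.
rewrite !big_ord_recl big_ord0 /jouanolou_form /= addr0.
rewrite (_ : ord0 = 0 :> 'I_3) // (_ : lift 0 0 = 1 :> 'I_3); last exact/val_inj.
rewrite (_ : lift 0 (lift 0 0) = 2%R :> 'I_3); last exact/val_inj.
by rewrite -/x -/y -/z !exprS; ring.
Qed.

Lemma jouanolou_zeros : exists s : seq 'rV[k]_3,
  forall P : 'rV[k]_3, P != 0 -> (forall i, (jouanolou_form i).@[P 0] = 0) ->
  exists2 Q, Q \in s & exists2 c : k, c != 0 & P = c *: Q.
Proof.
pose q : {poly k} := 'X^((d.+1 * d).+1) - 1.
have q0 : q != 0 by rewrite -size_poly_gt0 size_XnsubC.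
have [r qr] := closed_field_poly_normal q.
exists [seq \row_j [:: t; t ^+ d.+1; 1]`_j | t <- r] => P P0 zP.
pose a := P 0 0; pose b := P 0 1; pose c := P 0 2%R.
have PE : P = \row_j [:: a; b; c]`_j.
  apply/rowP => -[[|[|[|j]]] lt_j] //; rewrite mxE /=;
  by congr (P _ _); apply/val_inj.
have eA : a ^+ d * c = b ^+ d.+1.
  apply/subr0_eq; move: (zP 0); rewrite /jouanolou_form /=.
  by rewrite mevalB !mevalM !rmorphXn /= !meval_xyz.
have eB : a * b ^+ d = c ^+ d.+1.
  apply/subr0_eq; move: (zP 1); rewrite /jouanolou_form /=.
  by rewrite mevalB !mevalM !rmorphXn /= !meval_xyz.
have eC : c ^+ d * b = a ^+ d.+1.
  apply/subr0_eq; move: (zP 2%R); rewrite /jouanolou_form /=.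
  by rewrite mevalB !mevalM !rmorphXn /= !meval_xyz.
have c0 : c != 0.
  apply/eqP => c0; move: eA eB eC; rewrite c0 mulr0 => /esym/eqP.
  rewrite expf_eq0 /= => /eqP b0; rewrite b0 mulr0 => _ /esym/eqP.
  rewrite expf_eq0 /= => /eqP a0; move/eqP: P0; apply.
  by rewrite PE a0 b0 c0; apply/rowP => -[[|[|[|j]]] lt_j]; rewrite ?mxE.
have [t ac] : exists t, a = c * t by exists (a / c); rewrite mulrC divfK.
have bc : b = c * t ^+ d.+1.
  apply: (mulfI (expf_neq0 d c0)); rewrite eC ac exprMn.
  by rewrite mulrA -exprSr.
have t1 : t ^+ (d.+1 * d).+1 = 1.
  apply: (mulfI (expf_neq0 d.+1 c0)); rewrite mulr1 -[RHS]eB ac bc exprMn.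
  by rewrite mulrACA -exprM -!exprS.
exists (\row_j [:: t; t ^+ d.+1; 1]`_j); last first.
  exists c => //; rewrite PE ac bc; apply/rowP.
  by case=> [[|[|[|j]]] lt_j] //; rewrite !mxE /= ?mulr1.
apply: (map_f (fun t => \row_j [:: t; t ^+ d.+1; 1]`_j)).
have : root q t by rewrite rootE !hornerE t1 subrr.
by rewrite qr rootZ ?root_prod_XsubC // lead_coef_eq0.
Qed.

Definition jouanolou : foliation k d :=
  Foliation jouanolou_neq0 jouanolou_homog jouanolou_euler jouanolou_zeros.

End Jouanolou.

(* Main.v *)
(** Write [v = z^2 d/dx + x^2 d/dy + y^2 d/dz] for the homogeneous field tangent
    to the foliation. Hochschild's formula for [(a D)^p] shows that the single
    form [F = w(v^p)], of degree [p + 4], restricts up to units to the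
    p-divisor on every chart. It satisfies [v F = 0], because [v] commutes with
    [v^p] and preserves [w].

    The diagonal action of the 7th roots of unity with weights [(0, 1, 3)]
    preserves the foliation, hence [F] up to scalars. As 7 does not divide
    [p + 4], the prime factors of [F] cannot all have orbits of length 7, so
    some prime factor [g] is semi-invariant. Then [v g = l g] for a linear form
    [l] of weight [-1]; only the weights 0, 1 and 3 occur, so [l = 0]. (If the
    multiplicity of [g] is divisible by [p], then [F = g^p h] with [h] a
    quartic killed by [v].) Thus [F = g h] with [v g = v h = 0].

    At the singular point [P = (1 : 1 : 1)] the eigenvalue ratio of the
    foliation is not in [F_p], as [p = 2 mod 3]. Consequently a first integral
    of degree prime to [p] vanishes to order 2 at [P], whereas [F] vanishes
    there to order exactly 2. So [p] divides the degree of [g] or that of [h],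
    and one of them is constant or the other one is a quartic; but [v] has no
    quartic first integral. *)

From HB Require Import structures.
Require Import Defs.
From mathcomp Require Import all_boot all_algebra.
From mathcomp Require Import mpoly zify ring.
From Stdlib Require Import Classical_Prop.

Set Implicit Arguments.
Unset Strict Implicit.
Unset Printing Implicit Defensive.

Import GRing.Theory.
Local Open Scope ring_scope.

(** * Unique factorization *)

Section Divisibility.

Variable R : idomainType.
Implicit Types a b c q : R.

Definition divides a b := exists c, b = a * c.

Definition prime_elt q :=
  [/\ q != 0, q \isn't a GRing.unit &
      forall a b, divides q (a * b) -> divides q a \/ divides q b].

Definition irred_elt q :=
  [/\ q != 0, q \isn't a GRing.unit &
      forall a b, q = a * b -> a \is a GRing.unit \/ b \is a GRing.unit].

(** Stated with primes rather than irreducibles: the mere existence of such a factorization then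
    entails its uniqueness. *)
Definition factorial := forall a, a != 0 ->
  exists u (s : seq R), [/\ u \is a GRing.unit,
    forall q, q \in s -> prime_elt q & a = u * \prod_(q <- s) q].

Lemma divides_refl a : divides a a.
Proof. by exists 1; rewrite mulr1. Qed.

Lemma divides_trans b a c : divides a b -> divides b c -> divides a c.
Proof. by case=> x -> [y ->]; exists (x * y); rewrite mulrA. Qed.

Lemma dividesMr a b c : divides a b -> divides a (b * c).
Proof. by case=> x ->; exists (x * c); rewrite mulrA. Qed.

Lemma dividesMl a b c : divides a b -> divides a (c * b).
Proof. by rewrite mulrC; exact: dividesMr. Qed.

Lemma divides_unitM a u b : u \is a GRing.unit -> divides a (u * b) -> divides a b.
Proof. by move=> uu [c e]; exists (u^-1 * c); rewrite mulrCA -e mulKr. Qed.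

Lemma dvd_unit q u : u \is a GRing.unit -> divides q u -> q \is a GRing.unit.
Proof. by move=> uu [c e]; move: uu; rewrite e unitrM => /andP[]. Qed.

Lemma prime_prod q (s : seq R) :
  prime_elt q -> divides q (\prod_(x <- s) x) -> exists2 x, x \in s & divides q x.
Proof.
case=> q0 qu qp; elim: s => [|x s IH]; rewrite ?big_nil ?big_cons.
  by move/(dvd_unit (unitr1 _)); rewrite (negbTE qu).
case/qp => [qx|/IH[y ys qy]]; first by exists x; rewrite ?mem_head.
by exists y => //; rewrite inE ys orbT.
Qed.

Lemma prime_assoc q x : prime_elt x -> q \isn't a GRing.unit -> divides q x ->
  exists2 u, u \is a GRing.unit & x = q * u.
Proof.
case=> x0 xu xp qu [c e]; exists c => //.
have [] := xp q c; first by rewrite -e; exact: divides_refl.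
  case=> d eq_q; have : x * (d * c) = x * 1 by rewrite mulrA -eq_q mulr1 -e.
  by move/(mulfI x0) => dc; apply/unitrP; exists d; rewrite [c * _]mulrC.
case=> d ec; have : x * (q * d) = x * 1 by rewrite mulrCA -ec mulr1 -e.
by move/(mulfI x0) => qd; case/unitrP: qu; exists d; rewrite [d * _]mulrC.
Qed.

(** Induction on [n]: the last prime divides the product of the others times a cofactor. If it
    divided an earlier [q i], the two would be associates and [q i] would divide it. So it divides
    the cofactor. *)
Lemma prime_family_dvd (n : nat) (q : nat -> R) a :
  (forall i, (i < n)%N -> prime_elt (q i)) ->
  (forall i j, (i < j < n)%N -> ~ divides (q i) (q j)) ->
  (forall i, (i < n)%N -> divides (q i) a) ->
  divides (\prod_(i < n) q i) a.
Proof.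
elim: n => [|n IH] qp qn qa; first by exists a; rewrite big_ord0 mul1r.
have [|||b eb] := IH; first by move=> i /ltnW; exact: qp.
- by move=> i j /andP[ij jn]; apply: qn; rewrite ij ltnW.
- by move=> i /ltnW; exact: qa.
have [_ qnu qnp] := qp n (ltnSn n).
have [||[c ec]] := qnp (\prod_(i < n) q i) b; first by rewrite -eb; exact: qa.
  rewrite -(big_mkord xpredT) -(big_map q xpredT id) => /(prime_prod (qp n (ltnSn n))).
  case=> x /mapP[i]; rewrite mem_index_iota => /= lt_in -> dv; exfalso.
  have [u uu eq_qi] := prime_assoc (qp i (ltnW lt_in)) qnu dv.
  apply: (qn i n); first by rewrite lt_in ltnSn.
  by exists u^-1; rewrite eq_qi mulrK.
by exists c; rewrite big_ord_recr /= -mulrA -ec.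
Qed.

Lemma prime_irred q : prime_elt q -> irred_elt q.
Proof.
case=> q0 qu qp; split=> // a b e.
have aux x y : q = x * y -> divides q x -> y \is a GRing.unit.
  move=> exy [d ex]; have : q * (d * y) = q * 1 by rewrite mulrA -ex mulr1 -exy.
  by move/(mulfI q0) => dy; apply/unitrP; exists d; rewrite [y * _]mulrC.
have [] := qp a b; first by rewrite -e; exact: divides_refl.
  by move=> /aux h; right; apply: h.
by move=> /aux h; left; apply: h; rewrite mulrC.
Qed.

Lemma factorial_prime_divisor : factorial -> forall a,
  a != 0 -> a \isn't a GRing.unit -> exists2 q, prime_elt q & divides q a.
Proof.
move=> facR a a0 au; have [u [s [uu sp ea]]] := facR a a0.
case: s sp ea => [|x s] sp ea; first by rewrite ea big_nil mulr1 uu in au.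
exists x; first by apply: sp; rewrite mem_head.
by rewrite ea big_cons mulrCA; apply/dividesMr/divides_refl.
Qed.

End Divisibility.

(** * Gauss's lemma: polynomials over a factorial domain *)

Section Gauss.

Variable R : idomainType.
Implicit Types f g h : {poly R}.

Lemma polyC_unit (c : R) : (c%:P \is a GRing.unit) = (c \is a GRing.unit).
Proof.
rewrite poly_unitE size_polyC coefC /=.
by case: (eqVneq c 0) => [->|] //=; rewrite unitr0.
Qed.

Lemma prime_polyC (q : R) : prime_elt q -> prime_elt q%:P.
Proof.
case=> q0 qu qp; split; rewrite ?polyC_eq0 ?polyC_unit // => f g.
move: {2}(size f + size g)%N (leqnn (size f + size g)) => n.
elim: n f g => [|n IH] f g le_n dv.
  left; have/eqP : size f == 0 by rewrite -leqn0 (leq_trans (leq_addr _ _) le_n).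
  by move/eqP; rewrite size_poly_eq0 => /eqP->; exists 0; rewrite mulr0.
have [->|f0] := eqVneq f 0; first by left; exists 0; rewrite mulr0.
have [->|g0] := eqVneq g 0; first by right; exists 0; rewrite mulr0.
have step h : h != 0 -> divides q (lead_coef h) -> exists2 h' : {poly R},
    (size h' < size h)%N & exists d : {poly R}, h = h' + q%:P * d.
  move=> h0 [c hc]; exists (h - (c *: 'X^((size h).-1)) * q%:P).
    have sh : size h = (size h).-1.+1 by rewrite prednK ?size_poly_gt0.
    rewrite [X in (_ < X)%N]sh ltnS; apply/leq_sizeP => j.
    rewrite leq_eqVlt => /predU1P[<-|lt_j].
      rewrite coefB coefMC coefZ coefXn eqxx mulr1 -lead_coefE hc mulrC.
      by rewrite subrr.
    rewrite coefB coefMC coefZ coefXn (gtn_eqF lt_j) mulr0 mul0r subr0.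
    by rewrite nth_default // sh.
  by exists (c *: 'X^((size h).-1)); rewrite mulrC subrK.
have : divides q (lead_coef f * lead_coef g).
  by case: dv => d e; exists (lead_coef d); rewrite -lead_coefM e lead_coefM lead_coefC.
have red h' d : divides q%:P h' -> divides q%:P (h' + q%:P * d).
  by case=> x ->; exists (x + d); rewrite mulrDr.
have redV h' d : divides q%:P (h' + q%:P * d) -> divides q%:P h'.
  by case=> x e; exists (x - d); rewrite mulrBr -e addrK.
case/qp => [/(step f f0)|/(step g g0)] [h' lt_h [d e]].
  have [||?|] := IH h' g; first by rewrite -ltnS (leq_trans _ le_n) // ltn_add2r.
  - by move: dv; rewrite e mulrDl -mulrA => /redV.
  - by left; rewrite e; apply: red.
  by right.
have [|||?] := IH f h'; first by rewrite -ltnS (leq_trans _ le_n) // ltn_add2l.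
- by move: dv; rewrite e mulrDr mulrCA => /redV.
- by left.
by right; rewrite e; apply: red.
Qed.

Hypothesis facR : factorial R.

Let primitive f := forall q : R, prime_elt q -> ~ divides q%:P f.

(** The primes of [c] are cancelled one at a time: each divides [f * h] but not the primitive [f],
    hence it divides [h]. *)
Lemma strip_dvd f g h (c : R) :
  primitive f -> c != 0 -> c *: g = f * h -> divides f g.
Proof.
move=> fP c0; have [u [s [uu sp ->]]] := facR c0.
rewrite -mul_polyC; elim: s h sp => [|q s IH] h sp.
  rewrite big_nil mulr1 => e; apply: (@divides_unitM _ _ u%:P).
    by rewrite polyC_unit.
  by exists h.
rewrite big_cons mulrCA polyCM => e.
have qp : prime_elt q by apply: sp; rewrite mem_head.
have [q0 qu qd] := prime_polyC qp.
have [|/fP[]|] // := qd f h.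
  by rewrite -e -mulrA; apply/dividesMr/divides_refl.
case=> h' eh; apply: (IH h') => [x xs|]; first by apply: sp; rewrite inE xs orbT.
by apply: (mulfI q0); rewrite mulrA e eh mulrCA.
Qed.

(** A factorization over the fraction field, with denominators cleared by [c], descends to [R]: each
    prime of [c] divides [g] or [h] and is removed from that factor, which keeps its degree. *)
Lemma strip_factor f g h (c : R) : c != 0 -> c *: f = g * h ->
  exists g' h', [/\ f = g' * h', size g' = size g & size h' = size h].
Proof.
move=> c0; have [u [s [uu sp ->]]] := facR c0.
rewrite -mul_polyC; elim: s g h sp => [|q s IH] g h sp.
  rewrite big_nil mulr1 => e; exists (u^-1 *: g), h; split=> //.
    by rewrite -scalerAl -e -mul_polyC mulrA -polyCM mulVr // mul1r.
  by rewrite size_scale // invr_eq0; apply: contraTneq uu => ->; rewrite unitr0.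
rewrite big_cons mulrCA polyCM => e.
have [q0 qu qd] : prime_elt q%:P by apply/prime_polyC/sp; rewrite mem_head.
have qnz : q != 0 by rewrite -polyC_eq0.
have sp' : forall x, x \in s -> prime_elt x.
  by move=> x xs; apply: sp; rewrite inE xs orbT.
have [||[d ed]] := qd g h; first by rewrite -e -mulrA; apply/dividesMr/divides_refl.
  case=> d ed; have [|g' [h' [-> sg sh]]] := IH d h sp'.
    by apply: (mulfI q0); rewrite mulrA e ed mulrA.
  by exists g', h'; rewrite ed mul_polyC size_scale.
have [|g' [h' [-> sg sh]]] := IH g d sp'.
  by apply: (mulfI q0); rewrite mulrA e ed mulrCA.
by exists g', h'; rewrite ed mul_polyC size_scale.
Qed.

Lemma irred_primitive f : irred_elt f -> (1 < size f)%N -> primitive f.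
Proof.
move=> [f0 fu fi] sf q [q0 qu _] [g e].
case: (fi _ _ e); first by rewrite polyC_unit (negbTE qu).
rewrite poly_unitE => /andP[/eqP sg _].
by move: sf; rewrite e mul_polyC size_scale ?sg.
Qed.

(** [dvdp] is divisibility up to a nonzero scalar, that is, over the fraction field. There either
    [f] is coprime to [g] and divides [h], or their gcd has positive degree. In the second case
    [strip_factor] gives a true factor of [f] of the size of the gcd, so irreducibility forces the
    gcd to be [f] up to scalars. *)
Lemma irred_prime_poly f : irred_elt f -> (1 < size f)%N -> prime_elt f.
Proof.
move=> fI sf; have fP := irred_primitive fI sf; case: fI => f0 fu fi.
have dvdE g : Pdiv.Idomain.dvdp f g -> divides f g.
  case/Pdiv.Idomain.dvdpP => -[c h] /= c0 e.
  by apply: (@strip_dvd f g h c) => //; rewrite e mulrC.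
split=> // g h [d e].
have dvd_gh : (f %| g * h)%R.
  by apply/Pdiv.Idomain.dvdpP; exists (1, d); rewrite ?oner_eq0 //= scale1r e mulrC.
have [cop|ncop] := boolP (coprimep f g).
  by right; apply: dvdE; rewrite Pdiv.Idomain.Gauss_dvdpr in dvd_gh.
left; apply: dvdE; have := Pdiv.Idomain.dvdp_gcdl f g.
case/(@Pdiv.Idomain.dvdpP R) => -[c q] /= c0 ef.
have gcd0 : gcdp f g != 0 by rewrite Pdiv.Idomain.gcdp_eq0 negb_and f0.
have [q' [d' [ef' sq sd]]] := strip_factor c0 ef.
have ud : d' \isn't a GRing.unit.
  rewrite poly_unitE sd -Pdiv.Idomain.coprimep_def (negbTE ncop) //.
case: (fi _ _ ef') => [|dU]; last by rewrite dU in ud.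
rewrite poly_unitE => /andP[/eqP sq1 _].
have d0 : d' != 0 by apply: contraNneq f0 => d0; rewrite ef' d0 mulr0.
have q0 : q' != 0 by rewrite -size_poly_eq0 sq1.
have sfd : size (gcdp f g) == size f.
  by rewrite -sd [in X in _ == X]ef' size_mul // sq1.
have := Pdiv.Idomain.dvdp_size_eqp (Pdiv.Idomain.dvdp_gcdl f g).
rewrite sfd => /esym /Pdiv.Idomain.eqp_dvdl => <-.
exact: Pdiv.Idomain.dvdp_gcdr.
Qed.

(** A prime constant dividing [f] divides its leading coefficient, so the number of prime factors of
    the latter bounds how often one can be divided out. *)
Lemma content f : f != 0 ->
  exists c g, [/\ c != 0, f = c *: g & primitive g].
Proof.
move=> f0; have lf0 : lead_coef f != 0 by rewrite lead_coef_eq0.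
have [u [s [uu sp elf]]] := facR lf0.
move: {2}(size s) (erefl (size s)) => n es.
elim: n f f0 {lf0} s u uu sp elf es => [|n IH] f f0 s u uu sp elf es.
  exists 1, f; split; rewrite ?oner_eq0 ?scale1r // => q [q0 qu _] [g e].
  have : lead_coef f = u by rewrite elf (size0nil es) big_nil mulr1.
  rewrite e mul_polyC lead_coefZ => eu.
  by move: uu; rewrite -eu unitrM (negbTE qu).
have [|nP] := classic (primitive f).
  by exists 1, f; split; rewrite ?oner_eq0 ?scale1r.
have [q qp [g e]] : exists2 q, prime_elt q & divides q%:P f.
  apply: NNPP => nq; apply: nP => q qp qf; apply: nq; by exists q.
have [q0 qu _] := qp.
have qP : divides q (\prod_(x <- s) x).
  apply: (divides_unitM uu); exists (lead_coef g).
  by rewrite -elf e mul_polyC lead_coefZ.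
have [x xs qx] := prime_prod qp qP.
have [w wu ex] := prime_assoc (sp x xs) qu qx.
have g0 : g != 0 by apply: contraNneq f0 => g0; rewrite e g0 mulr0.
(* Dividing by [q] removes the associate [x = q * w] from the list; the unit [w] joins [u]. *)
have [||||c [h [c0 eg hP]]] := IH g g0 (rem x s) (u * w).
- by rewrite unitrM uu.
- by move=> y /mem_rem; exact: sp.
- apply: (mulfI q0); rewrite -lead_coefZ -mul_polyC -e elf.
  rewrite (perm_big _ (perm_to_rem xs)) big_cons /= ex.
  by rewrite !mulrA [u * q]mulrC.
- by rewrite size_rem // es.
exists (q * c), h; split=> //; first exact: mulf_neq0.
by rewrite e eg -scalerA mul_polyC.
Qed.

(** The content is factored in [R]. A primitive nonconstant polynomial is either irreducible, hence
    prime, or a product of two nonunits; primitivity makes both nonconstant, so both have smaller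
    degree. *)
Lemma factorial_poly : factorial {poly R}.
Proof.
have facC (c : R) : c != 0 -> exists u (s : seq {poly R}), [/\ u \is a GRing.unit,
    forall q, q \in s -> prime_elt q & c%:P = u * \prod_(q <- s) q].
  move=> /facR[u [s [uu sp ->]]]; exists u%:P, (map polyC s).
  split; rewrite ?polyC_unit //; first by move=> ? /mapP[q /sp qp ->]; exact: prime_polyC.
  by rewrite big_map polyCM rmorph_prod.
have join (f g : {poly R}) :
    (exists u (s : seq {poly R}), [/\ u \is a GRing.unit,
      forall q, q \in s -> prime_elt q & f = u * \prod_(q <- s) q]) ->
    (exists u (s : seq {poly R}), [/\ u \is a GRing.unit,
      forall q, q \in s -> prime_elt q & g = u * \prod_(q <- s) q]) ->
    exists u (s : seq {poly R}), [/\ u \is a GRing.unit,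
      forall q, q \in s -> prime_elt q & f * g = u * \prod_(q <- s) q].
  case=> u [s [uu sp ->]] [v [t [vu tp ->]]]; exists (u * v), (s ++ t).
  rewrite unitrM uu big_cat mulrACA; split=> // q.
  by rewrite mem_cat => /orP[/sp|/tp].
move=> f; move: {2}(size f) (leqnn (size f)) => n.
elim: n f => [|n IH] f le_n f0.
  by rewrite -size_poly_eq0 -leqn0 le_n in f0.
have [c [g [c0 eg gP]]] := content f0.
rewrite eg -mul_polyC; apply: (join _ _ (facC c c0)).
have g0 : g != 0 by apply: contraNneq f0 => g0; rewrite eg g0 scaler0.
have sg : (size g <= n.+1)%N by rewrite -(size_scale g c0) -eg.
have constE h : h != 0 -> (size h <= 1)%N -> exists2 a, a != 0 & h = a%:P.
  by move=> h0 /size1_polyC eh; exists h`_0; rewrite // -polyC_eq0 -eh.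
have [s1|s1] := leqP (size g) 1.
  by have [a a0 ->] := constE g g0 s1; apply: facC.
have [gI|gN] := classic (irred_elt g).
  exists 1, [:: g]; rewrite unitr1 big_seq1 mul1r; split=> // q.
  by rewrite inE => /eqP->; exact: irred_prime_poly.
have [a [b [eab au bu]]] : exists a b, [/\ g = a * b,
    a \isn't a GRing.unit & b \isn't a GRing.unit].
  apply: NNPP => nab; apply: gN; split=> // [|a b eab].
    by rewrite poly_unitE negb_and (gtn_eqF s1).
  case aU: (a \is a GRing.unit); first by left.
  case bU: (b \is a GRing.unit); first by right.
  by case: nab; exists a, b; rewrite aU bU.
have a0 : a != 0 by apply: contraNneq g0 => a0; rewrite eab a0 mul0r.
have b0 : b != 0 by apply: contraNneq g0 => b0; rewrite eab b0 mulr0.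
have big h : h != 0 -> h \isn't a GRing.unit -> divides h g -> (1 < size h)%N.
  move=> h0 hu hg; rewrite ltnNge; apply/negP => /(constE _ h0)[d d0 ed].
  move: hu hg; rewrite ed polyC_unit => du.
  have [q qp qd] := factorial_prime_divisor facR d0 du.
  move=> dg; apply: (gP q qp); apply: divides_trans dg.
  by case: qd => x ->; exists x%:P; rewrite polyCM.
have sa := big a a0 au (ex_intro _ b eab).
have sb : (1 < size b)%N by apply: (big b b0 bu); exists a; rewrite mulrC.
move: sg; rewrite eab size_mul // => sg; apply: join; apply: IH => //.
  by move: sa sb sg; lia.
by move: sa sb sg; lia.
Qed.

End Gauss.

(** * Factoriality of polynomial rings in several variables *)

Lemma prime_elt_iso (A B : idomainType) (f : {rmorphism A -> B})
    (g : {rmorphism B -> A}) q :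
  cancel f g -> cancel g f -> prime_elt q -> prime_elt (g q).
Proof.
move=> fK gK [q0 qu qp]; split.
- by apply: contraNneq q0 => gq0; rewrite -[q]gK gq0 rmorph0.
- by apply: contraNN qu => /(rmorph_unit f); rewrite gK.
have fdv x : divides q (f x) -> divides (g q) x.
  by case=> d e; exists (g d); rewrite -[x]fK e rmorphM.
move=> x y [d e]; have [|/fdv|/fdv] := qp (f x) (f y); [|by left|by right].
by exists (f d); rewrite -rmorphM e rmorphM gK.
Qed.

Lemma factorial_iso (A B : idomainType) (f : {rmorphism A -> B})
    (g : {rmorphism B -> A}) : cancel f g -> cancel g f -> factorial B -> factorial A.
Proof.
move=> fK gK facB a a0.
have [|u [s [uu sp efa]]] := facB (f a).
  by apply: contraNneq a0 => fa0; rewrite -[a]fK fa0 rmorph0.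
exists (g u), (map g s); split; first exact: rmorph_unit.
  by move=> _ /mapP[q /sp qp ->]; apply: prime_elt_iso qp.
by rewrite big_map -[a]fK efa rmorphM rmorph_prod.
Qed.

Lemma mpoly_rmorph_ext n (R : comNzRingType) (S : comNzRingType)
    (f g : {rmorphism {mpoly R[n]} -> S}) :
  (forall c, f c%:MP = g c%:MP) -> (forall i, f 'X_i = g 'X_i) -> f =1 g.
Proof.
move=> fgC fgX; elim/mpolyind => [|c m p _ _ IH]; first by rewrite !rmorph0.
rewrite !rmorphD /= IH -mul_mpolyC !rmorphM /= fgC; congr (_ * _ + _).
rewrite mpolyXE_id !rmorph_prod; apply: eq_bigr => i _.
by rewrite !rmorphXn /= fgX.
Qed.

Section MPoly.

Local Notation widen := (widen_ord (leqnSn _)).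

Variables (n : nat) (R : idomainType).

(** Inverse to [muni], which singles out the last variable. *)
Definition mpoly_of_poly (p : {poly {mpoly R[n]}}) : {mpoly R[n.+1]} :=
  (map_poly (@mwiden n R) p).['X_ord_max].

Fact mpoly_of_poly_additive : additive mpoly_of_poly.
Proof. by move=> p q; rewrite /mpoly_of_poly rmorphB hornerD hornerN. Qed.

Fact mpoly_of_poly_multiplicative : multiplicative mpoly_of_poly.
Proof.
by split=> [p q|]; rewrite /mpoly_of_poly ?rmorphM ?hornerM ?rmorph1 ?hornerC.
Qed.

HB.instance Definition _ := GRing.isAdditive.Build _ _ mpoly_of_poly
  mpoly_of_poly_additive.
HB.instance Definition _ := GRing.isMultiplicative.Build _ _ mpoly_of_poly
  mpoly_of_poly_multiplicative.

Lemma muni_Xmax : muni ('X_ord_max : {mpoly R[n.+1]}) = 'X.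
Proof.
rewrite muniE msuppX big_seq1 mcoeffX eqxx scale1r mnm1E eqxx expr1.
rewrite (_ : [multinom _ | _ < _] = 0%MM) ?mpolyX0 ?scale1r //.
by apply/mnmP => i; rewrite mnmE mnm1E mnm0E -val_eqE /= gtn_eqF.
Qed.

Lemma muni_Xwiden i : muni ('X_(widen i) : {mpoly R[n.+1]}) = ('X_i)%:P.
Proof.
rewrite muniE msuppX big_seq1 mcoeffX eqxx scale1r mnm1E -val_eqE /= ltn_eqF //.
rewrite expr0 alg_polyC; congr (_%:P); congr 'X_[_].
by apply/mnmP => j; rewrite mnmE !mnm1E -!val_eqE.
Qed.

Lemma widen_or_max (i : 'I_n.+1) : i = ord_max \/ exists j : 'I_n, i = widen j.
Proof.
have [lt_in|] := ltnP i n; first by right; exists (Ordinal lt_in); apply/val_inj.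
by move=> le_ni; left; apply/val_inj/eqP; rewrite eqn_leq le_ni -ltnS ltn_ord.
Qed.

Lemma mpoly_of_polyC p : mpoly_of_poly p%:P = mwiden p.
Proof. by rewrite /mpoly_of_poly map_polyC hornerC. Qed.

Lemma mwidenXU i : mwiden ('X_i : {mpoly R[n]}) = 'X_(widen i).
Proof. by rewrite /mwiden mmapX mmap1U. Qed.

Lemma muniK : cancel (@muni n R) mpoly_of_poly.
Proof.
apply: (mpoly_rmorph_ext (f := mpoly_of_poly \o @muni n R) (g := idfun)).
  by move=> c; rewrite /= muniC mpoly_of_polyC mwidenC.
move=> i; have [->|[j ->]] /= := widen_or_max i.
  by rewrite muni_Xmax /mpoly_of_poly map_polyX hornerX.
by rewrite muni_Xwiden mpoly_of_polyC mwidenXU.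
Qed.

Lemma mpoly_of_polyK : cancel mpoly_of_poly (@muni n R).
Proof.
have KC (p : {mpoly R[n]}) : muni (mwiden p) = p%:P.
  move: p; apply: (mpoly_rmorph_ext (f := @muni n R \o @mwiden n R) (g := polyC)) => [c|i] /=.
    by rewrite mwidenC muniC.
  by rewrite mwidenXU muni_Xwiden.
elim/poly_ind => [|p c IH]; first by rewrite !rmorph0.
rewrite !rmorphD !rmorphM /= IH mpoly_of_polyC KC.
by rewrite [mpoly_of_poly 'X]/mpoly_of_poly map_polyX hornerX muni_Xmax.
Qed.

End MPoly.

Lemma factorial_mpoly n (k : fieldType) : factorial {mpoly k[n]}.
Proof.
elim: n => [|n IH].
  move=> p p0; exists p, [::]; split; rewrite ?big_nil ?mulr1 //.
  move: p0; rewrite (nvar0_mpolyC p) mpolyC_eq0 => c0.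
  by rewrite (rmorph_unit (@mpolyC 0 k)) // unitfE.
exact: (factorial_iso (@muniK n k) (@mpoly_of_polyK n k) (factorial_poly IH)).
Qed.

(** * Homogeneous polynomials *)

(** Evaluation at 0 shows that ['X] divides one of the factors as long as [n] is positive; it is
    cancelled until both sides are constant. *)
Lemma monomial_factor (R : idomainType) (p q : {poly R}) c n :
  c != 0 -> p * q = c *: 'X^n -> exists a i, p = a *: 'X^i.
Proof.
move=> c0; elim: n p q => [|n IH] p q.
  rewrite expr0 alg_polyC => e.
  have pq0 : p * q != 0 by rewrite e polyC_eq0.
  have p0 : p != 0 by apply: contraNneq pq0 => ->; rewrite mul0r.
  have q0 : q != 0 by apply: contraNneq pq0 => ->; rewrite mulr0.
  have s1 : (size p <= 1)%N.
    move: (congr1 (size : {poly R} -> nat) e); rewrite size_mul // size_polyC c0.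
    by move: q0; rewrite -size_poly_gt0; lia.
  by exists p`_0, 0%N; rewrite expr0 alg_polyC -size1_polyC.
move=> e; have /eqP := congr1 (fun f : {poly R} => f.[0]) e.
rewrite hornerM hornerZ hornerXn expr0n mulr0 mulf_eq0.
have Xreg : ('X : {poly R}) != 0 by rewrite polyX_eq0.
case/orP => /factor_theorem[r]; rewrite polyC0 subr0 => er.
  have [|a [i]] := IH r q.
    by apply: (mulIf Xreg); rewrite mulrAC -er e exprSr scalerAl.
  by move=> er'; exists a, i.+1; rewrite er er' exprSr scalerAl.
apply: (IH p r); apply: (mulIf Xreg).
by rewrite -mulrA -er e exprSr scalerAl.
Qed.

Section Homogeneous.

Variables (n : nat) (k : fieldType).
Implicit Types (f g h : {mpoly k[n]}) (d e : nat).

(** The substitution of [T * x_i] for [x_i]: a ring morphism that records the homogeneous parts of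
    [f] as the coefficients of the powers of [T]. *)
Let grade f : {poly {mpoly k[n]}} :=
  mmap (polyC \o @mpolyC n k) (fun i : 'I_n => ('X_i *: 'X : {poly {mpoly k[n]}})) f.

Let gradeM f g : grade (f * g) = grade f * grade g.
Proof. exact: rmorphM. Qed.

Let gradeE f i : (grade f)`_i = pihomog (@mdeg n) i f.
Proof.
elim/mpolyind: f => [|c m f _ _ IH]; first by rewrite /grade rmorph0 coef0 pihomog0.
rewrite pihomogD -IH /grade rmorphD coefD; congr (_ + _).
rewrite [RHS]linearZ /= pihomogX mmapZ mmapX /= /mmap1 coefCM.
under eq_bigr => j _ do rewrite exprZn.
rewrite scaler_prod prodrXr -mdegE -mpolyXE_id coefZ coefXn eq_sym.
by case: eqP => _; rewrite ?mulr1 ?mulr0 ?scaler0 ?mul_mpolyC.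
Qed.

(** [grade f] is the monomial [f T^d], and a factor of a monomial in [T] is a monomial in [T]. *)
Lemma homog_factor f g h d : f != 0 -> f \is d.-homog -> f = g * h ->
  exists d1, g \is d1.-homog.
Proof.
move=> f0 fd e; have gf : grade f = f *: 'X^d.
  apply/polyP => i; rewrite gradeE coefZ coefXn; case: eqP => [->|/eqP ne].
    by rewrite mulr1; apply: pihomog_dE.
  by rewrite mulr0 (pihomog_ne0 _ fd) // eq_sym.
have [a [i gg]] : exists a i, grade g = a *: 'X^i.
  by apply: (@monomial_factor _ _ (grade h) f d f0); rewrite -gradeM -e.
exists i; rewrite (pihomog_partitionE (leqnn (mmeasure (@mdeg n) g))).
apply: rpred_sum => j _; have [->|ne] := eqVneq (j : nat) i; first exact: pihomogP.
by rewrite -gradeE gg coefZ coefXn (negbTE ne) mulr0 rpred0.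
Qed.

Lemma homog_mulE f g d d1 d2 : f * g != 0 -> f * g \is d.-homog ->
  f \is d1.-homog -> g \is d2.-homog -> (d1 + d2)%N = d.
Proof. by move=> fg0 fgd fa gb; apply: (dhomog_uniq fg0) fgd; apply: dhomogM. Qed.

Lemma homog0_const f : f \is 0.-homog -> f = (f@_0)%:MP.
Proof.
move=> f0; apply/mpolyP => m; rewrite mcoeffC; case: eqP => [->|/eqP m0].
  by rewrite mulr1.
by rewrite mulr0; apply: (dhomog_nemf_coeff f0); rewrite mdeg_eq0.
Qed.

Lemma homog_unit f d : f != 0 -> f \is d.-homog -> (f \is a GRing.unit) = (d == 0%N).
Proof.
move=> f0 fd; apply/idP/idP => [|/eqP d0].
  case/unitrP => g [gf fg]; have fg0 : f * g != 0 by rewrite fg oner_eq0.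
  have g0 : g != 0 by apply: contraNneq fg0 => ->; rewrite mulr0.
  have one_h : (1 : {mpoly k[n]}) \is 0.-homog by exact: dhomog1.
  have [b gb] := homog_factor (oner_neq0 _) one_h (esym gf).
  have fgh : f * g \is 0.-homog by rewrite fg.
  by have /eqP := homog_mulE fg0 fgh fd gb; rewrite addn_eq0 => /andP[].
have ef : f = (f@_0)%:MP by move: fd; rewrite d0; exact: homog0_const.
by rewrite ef (rmorph_unit (@mpolyC n k)) // unitfE -(mpolyC_eq0 n) -ef.
Qed.

Lemma mderiv_homog i f d : f \is d.-homog -> mderiv i f \is d.-1.-homog.
Proof.
move=> fd; rewrite /mderiv big_seq; apply: rpred_sum => m ms; rewrite -mul_mpolyC.
have [m0|m0] := eqVneq (m i) 0%N; first by rewrite m0 mul0r mpolyC0 mul0r rpred0.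
rewrite mul_mpolyC rpredZ // dhomogX /= -(dhomog_mf fd ms).
have lem : (U_(i) <= m)%MM.
  by apply/mnm_lepP => j; rewrite mnm1E; case: eqP => [<-|] //; rewrite lt0n.
have em : mdeg m = (mdeg (m - U_(i))%MM).+1.
  by rewrite -{1}(submK lem) mdegD mdeg1 addn1.
by rewrite /= em.
Qed.

Lemma euler f d : f \is d.-homog -> \sum_(i < n) 'X_i * mderiv i f = f *+ d.
Proof.
move=> fd; under eq_bigr => i _ do rewrite /mderiv mulr_sumr.
rewrite exchange_big /= [f in RHS]mpolyE -sumrMnl.
apply: eq_big_seq => m ms; rewrite -(dhomog_mf fd ms) /= mdegE -sumrMnr.
apply: eq_bigr => i _; rewrite -scalerAr mulr_natl.
have [m0|m0] := eqVneq (m i) 0%N; first by rewrite m0 !mulr0n scale0r.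
have lem : (U_(i) <= m)%MM.
  by apply/mnm_lepP => j; rewrite mnm1E; case: eqP => [<-|] //; rewrite lt0n.
by rewrite -mpolyXD addmC submK // scalerMnl.
Qed.

End Homogeneous.

(** * Hochschild's formula *)

Definition is_derivation (A : comNzRingType) (D : A -> A) :=
  {morph D : f g / f + g} /\ (forall f g, D (f * g) = D f * g + f * D g).

Section TwistedIterates.

Variables (A : comNzRingType) (D : A -> A) (K : A).
Hypothesis derD : is_derivation D.
Implicit Types f g : A.

Let DD : {morph D : f g / f + g}. Proof. by case: derD. Qed.
Let DM f g : D (f * g) = D f * g + f * D g. Proof. by case: derD. Qed.

Lemma derivation_0 : D 0 = 0.
Proof. by apply: (addrI (D 0)); rewrite -DD !addr0. Qed.

Lemma derivation_1 : D 1 = 0.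
Proof. by apply: (addrI (D 1)); rewrite addr0 -[in RHS](mulr1 1) DM mulr1 mul1r. Qed.

Lemma derivation_sumr (I : Type) (r : seq I) (P : pred I) (F : I -> A) :
  D (\sum_(i <- r | P i) F i) = \sum_(i <- r | P i) D (F i).
Proof. exact: (big_morph _ DD derivation_0). Qed.

Lemma derivation_muln f m : D (f *+ m) = D f *+ m.
Proof. by elim: m => [|m IH]; rewrite ?mulr0n ?derivation_0 // !mulrS DD IH. Qed.

(* [twisted d n] is the product of the operators [D + (d + i) K], [i < n]. In
   a ring containing [T] with [D T = T K], it is conjugate by [T ^ d] to
   [T^-n (T D)^n]. *)
Fixpoint twisted (d n : nat) f : A :=
  if n is m.+1 then D (twisted d m f) + K * twisted d m f *+ (d + m) else f.

(** Leibniz' formula survives the twist because the multiplier [d + e + m] splits as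
    [(d + (m - i)) + (e + i)] between the two factors. *)
Lemma twistedM d e n f g : twisted (d + e) n (f * g) =
  \sum_(i < n.+1) (twisted d (n - i) f * twisted e i g) *+ 'C(n, i).
Proof.
pose a i j := twisted d i f * twisted e j g.
elim: n => [|m IH]; first by rewrite big_ord1 /= bin0.
have step i : (i <= m)%N -> D (a (m - i)%N i) + K * a (m - i)%N i *+ (d + e + m)
    = a (m - i).+1 i + a (m - i)%N i.+1.
  move=> le_im; rewrite /a DM /= (_ : d + e + m = d + (m - i) + (e + i))%N; last lia.
  by rewrite mulrnDr; ring.
rewrite /= IH derivation_sumr mulr_sumr -sumrMnl -big_split /=.
transitivity (\sum_(i < m.+1) a (m - i).+1 i *+ 'C(m, i) +
              \sum_(i < m.+1) a (m - i)%N i.+1 *+ 'C(m, i)).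
  rewrite -big_split /=; apply: eq_bigr => i _.
  have le_im : (i <= m)%N by rewrite -ltnS.
  rewrite -mulrnDl -(step i le_im) mulrnDl derivation_muln.
  by rewrite mulrnAr mulrnAC.
rewrite [RHS]big_ord_recl [in LHS]big_ord_recl !bin0 !subn0 -addrA.
congr (_ + _).
transitivity (\sum_(i < m.+1) a (m - i)%N i.+1 *+ 'C(m, i.+1) +
              \sum_(i < m.+1) a (m - i)%N i.+1 *+ 'C(m, i)).
  congr (_ + _); rewrite [RHS]big_ord_recr /= bin_small // mulr0n addr0.
  by apply: eq_bigr => i _; rewrite /bump /= add1n subnSK.
rewrite -big_split /=; apply: eq_bigr => i _.
by rewrite -mulrnDr /bump /= add1n binS subSS.
Qed.

(** The coefficient of [D^s] when [twisted 0 n] is expanded in powers of [D]. *)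
Fixpoint twisted_coef (n s : nat) : A :=
  if n is m.+1 then D (twisted_coef m s) + K * twisted_coef m s *+ m
    + (if s is t.+1 then twisted_coef m t else 0)
  else (s == 0%N)%:R.

Lemma twisted_coef_gt n s : (n < s)%N -> twisted_coef n s = 0.
Proof.
elim: n s => [|n IH] [|s] //= lt_ns.
by rewrite !IH ?derivation_0 ?mulr0 ?mul0rn ?addr0 // ltnW.
Qed.

Lemma twisted_coefnn n : twisted_coef n n = 1.
Proof.
by elim: n => //= n ->; rewrite twisted_coef_gt // derivation_0 mulr0 mul0rn !add0r.
Qed.

Lemma twisted_coef0 n : twisted_coef n.+1 0 = 0.
Proof.
elim: n => [|n IH] /=; first by rewrite derivation_1 mulr0n !addr0.
by move: IH => /= ->; rewrite derivation_0 mulr0 mul0rn !addr0.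
Qed.

Lemma twistedE n f :
  twisted 0 n f = \sum_(s < n.+1) twisted_coef n s * iter s D f.
Proof.
elim: n => [|n IH]; first by rewrite big_ord1 /= mul1r.
rewrite [LHS]/= add0n IH derivation_sumr mulr_sumr -sumrMnl -big_split /=.
under [RHS]eq_bigr => s _ do rewrite mulrDl.
rewrite [RHS]big_split /= [X in _ = X + _]big_ord_recr /= (twisted_coef_gt (ltnSn n)) derivation_0.
rewrite mulr0 mul0rn addr0 mul0r addr0 [X in _ = _ + X]big_ord_recl /= mul0r add0r -big_split /=.
by apply: eq_bigr => s _; rewrite DM; ring.
Qed.

Variable p : nat.
Hypothesis charp : p \in [pchar A].

(** The inner binomial coefficients of [twistedM] vanish in characteristic [p]. For [d = e = 0] this
    makes [twisted 0 p] a derivation. *)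
Lemma twisted_char d e f g :
  twisted (d + e) p (f * g) = twisted d p f * g + f * twisted e p g.
Proof.
have p_pr := pcharf_prime charp.
case: p charp p_pr => // q chq q_pr.
rewrite twistedM big_ord_recl subn0 bin0 mulr1n; congr (_ + _).
rewrite big_ord_recr big1 => [|i _].
  by rewrite /= add0r /bump /= ?add1n ?addSn ?add0n subnn binn mulr1n.
have /dvdnP[c ->] : (q.+1 %| 'C(q.+1, lift ord0 (widen_ord (leqnSn q) i)))%N.
  by apply: prime_dvd_bin => //; rewrite /= /bump /= add1n ltnS ltn_ord.
by rewrite mulrnA -(mulr_natr _ q.+1) (pcharf0 chq) mulr0.
Qed.

End TwistedIterates.

Section Adjoin.

Variables (A : comNzRingType) (D : A -> A) (K : A).
Hypothesis derD : is_derivation D.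

(** The extension of [D] to [A[t]] with [D t = 1]. *)
Definition poly_derivation (q : {poly A}) : {poly A} :=
  \poly_(i < size q) D q`_i + q^`().

Let map_coef q i : (\poly_(i < size q) D q`_i)`_i = D q`_i.
Proof.
rewrite coef_poly; case: ltnP => // le_q.
by rewrite nth_default // (derivation_0 derD).
Qed.

Lemma poly_derivation_der : is_derivation poly_derivation.
Proof.
have [DD DM] := derD; split=> f g; rewrite /poly_derivation.
  rewrite derivD addrACA; congr (_ + _); apply/polyP => i.
  by rewrite coefD !map_coef coefD DD.
rewrite derivM mulrDl mulrDr addrACA; congr (_ + _); apply/polyP => i.
rewrite coefD !coefM map_coef coefM (derivation_sumr derD) -big_split /=.
by apply: eq_bigr => j _; rewrite !map_coef DM.
Qed.

Lemma poly_derivationC c : poly_derivation c%:P = (D c)%:P.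
Proof.
rewrite /poly_derivation derivC addr0; apply/polyP => i; rewrite map_coef !coefC.
by case: eqP => // _; rewrite (derivation_0 derD).
Qed.

Lemma iter_poly_derivationXn s m : iter s poly_derivation 'X^m = 'X^m^`(s).
Proof.
have E (a : nat) : poly_derivation ('X^m^`(a)) = 'X^m^`(a.+1).
  rewrite /poly_derivation derivnS -[RHS]add0r; congr (_ + _).
  apply/polyP => i; rewrite map_coef coef_derivn coefXn coef0.
  rewrite -(mulr_natr _ (_ ^_ _)) -natrM; elim: (_ * _)%N => [|j IH].
    exact: derivation_0.
  by rewrite -natr1; case: derD => -> _; rewrite IH (derivation_1 derD) addr0.
by elim: s => [|s IH]; rewrite ?derivn0 // iterS IH E.
Qed.

Lemma twisted_coef_polyC n s :
  twisted_coef poly_derivation K%:P n s = (twisted_coef D K n s)%:P.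
Proof.
elim: n s => [|n IH] s /=; first by rewrite polyC_natr.
rewrite IH poly_derivationC -polyCM -polyCMn -polyCD.
by case: s => [|s]; rewrite ?IH -?polyCD // addr0 addr0.
Qed.

End Adjoin.

(* Adjoining a variable [t] with [D t = 1] makes the iterates of [D]
   independent; since [twisted 0 p] is a derivation, it kills [t ^ m] at
   [t = 0] for [m > 1], which leaves only two of its coefficients. *)
Lemma hochschild (A : idomainType) (D : A -> A) (K : A) p :
    is_derivation D -> p \in [pchar A] ->
  exists c, forall f, twisted D K 0 p f = iter p D f + c * D f.
Proof.
move=> derD charp; have p_pr := pcharf_prime charp.
have derP := poly_derivation_der derD.
have charP : p \in [pchar {poly A}].
  by rewrite inE p_pr -polyC_natr (pcharf0 charp) eqxx.
have c0 m : (1 < m < p)%N -> twisted_coef D K p m = 0.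
  (* At [t = 0] the expansion on [t ^ m] retains only the term [s = m], which is [m!] times the
     coefficient; [m!] is nonzero as [m < p]. *)
  case/andP=> m1 mp; have := twistedE K%:P derP p 'X^m.
  move/(congr1 (fun q : {poly A} => q.[0])); rewrite horner_sum.
  rewrite (bigD1 (Ordinal (ltnW mp : m < p.+1)%N)) //= big1 => [|s /negbTE ne].
    rewrite twisted_coef_polyC // iter_poly_derivationXn // addr0 hornerM hornerC.
    rewrite [_^`(_).[0]]horner_coef0 coef_derivn coefXn addn0 eqxx ffactnn.
    have tM d q r : twisted (poly_derivation D) K%:P (0 + d) p (q * r) =
        twisted (poly_derivation D) K%:P 0 p q * r +
        q * twisted (poly_derivation D) K%:P d p r by exact: twisted_char.
    have -> : (twisted (poly_derivation D) K%:P 0 p 'X^m).[0] = 0.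
      have -> : ('X^m : {poly A}) = 'X * ('X * 'X^(m.-2)).
        by rewrite -!exprS; congr 'X^_; lia.
      by rewrite !(tM 0%N) !(hornerD, hornerM, hornerX) !(mul0r, mulr0, addr0).
    move/esym/eqP; rewrite mulf_eq0 => /orP[/eqP//|].
    rewrite -(dvdn_pcharf charp) => pm; exfalso.
    elim: m {m1} mp pm => [|m IH] mp; first by rewrite dvdn1 => /eqP ep; rewrite ep in p_pr.
    rewrite factS Euclid_dvdM // gtnNdvd //=; exact/IH/ltnW.
  rewrite hornerM iter_poly_derivationXn // [_^`(_).[0]]horner_coef0 coef_derivn coefXn.
  by rewrite -val_eqE /= in ne; rewrite addn0 ne mul0rn mulr0.
exists (twisted_coef D K p 1) => f; rewrite (twistedE _ derD).
have p2 := prime_gt1 p_pr.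
rewrite (bigD1 (Ordinal (ltnSn p))) //= twisted_coefnn // mul1r; congr (_ + _).
rewrite (bigD1 (Ordinal (ltnW p2 : 1 < p.+1)%N)) /=; last by rewrite -val_eqE /= ltn_eqF.
rewrite big1 ?addr0 // => -[s lt_s]; rewrite -!val_eqE /= => /andP[sp s1].
have [->|s0] := eqVneq s 0%N; last by rewrite c0 ?mul0r //; lia.
by case: (p) p2 => // q _; rewrite twisted_coef0 // mul0r.
Qed.

(** * Iterates of a vector field in the affine charts *)

Lemma mpoly_ring_ind n (R : comNzRingType) (P : {mpoly R[n]} -> Prop) :
  (forall c, P c%:MP) -> (forall i, P 'X_i) ->
  (forall f g, P f -> P g -> P (f + g)) ->
  (forall f g, P f -> P g -> P (f * g)) -> forall f, P f.
Proof.
move=> PC PX PD PM; elim/mpolyind => [|c m f _ _ Pf]; first by rewrite -mpolyC0.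
apply: PD Pf; rewrite -mul_mpolyC; apply: (PM) => //; rewrite mpolyXE_id.
apply: (big_ind P); [by rewrite -mpolyC1 | exact: PM | move=> i _].
by elim: (m i) => [|e IH]; rewrite ?exprS ?expr0 -?mpolyC1 //; apply: PM.
Qed.

Lemma mderivXU n (R : comNzRingType) (i j : 'I_n) :
  mderiv i ('X_j : {mpoly R[n]}) = (i == j)%:R.
Proof.
rewrite mderivX mnm1E eq_sym; case: eqP => [->|_]; last by rewrite scale0r.
rewrite scale1r (_ : (U_(j) - U_(j))%MM = 0%MM) ?mpolyX0 //.
by apply/mnmP => l; rewrite mnmBE subnn mnm0E.
Qed.

Section Charts.

Variables (k : fieldType) (i : 'I_3).
Implicit Types f g : {mpoly k[3]}.

Local Notation pi := (@dehomog k i).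

Lemma dehomog0 : pi 0 = 0.
Proof. exact: comp_mpoly0. Qed.

Lemma dehomogD f g : pi (f + g) = pi f + pi g.
Proof. exact: comp_mpolyD. Qed.

Lemma dehomogM f g : pi (f * g) = pi f * pi g.
Proof. exact: rmorphM. Qed.

Lemma dehomogMn f m : pi (f *+ m) = pi f *+ m.
Proof. exact: rmorphMn. Qed.

Lemma dehomog_sum (I : Type) (r : seq I) (P : pred I) (F : I -> {mpoly k[3]}) :
  pi (\sum_(j <- r | P j) F j) = \sum_(j <- r | P j) pi (F j).
Proof. exact: rmorph_sum. Qed.

Lemma dehomogX j : pi 'X_j = if unlift i j is Some l then 'X_l : {mpoly k[2]} else 1.
Proof. by rewrite /dehomog comp_mpolyXU -tnth_nth tnth_mktuple. Qed.

Lemma dehomogXi : pi 'X_i = 1.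
Proof. by rewrite dehomogX unlift_none. Qed.

Lemma dehomogXlift l : pi 'X_(lift i l) = 'X_l.
Proof. by rewrite dehomogX liftK. Qed.

Lemma mderiv_dehomog l f : mderiv l (pi f) = pi (mderiv (lift i l) f).
Proof.
elim/mpoly_ring_ind: f => [c|j|f g IHf IHg|f g IHf IHg].
- by rewrite /dehomog comp_mpolyC !mderivC comp_mpoly0.
- rewrite mderivXU dehomogX; case: unliftP => [m ->|->].
    by rewrite mderivXU (inj_eq lift_inj); case: eqP => _;
      rewrite ?dehomog0 // /dehomog comp_mpoly1.
  rewrite -mpolyC1 mderivC eq_sym (negbTE (neq_lift _ _)).
  by rewrite dehomog0.
- by rewrite dehomogD !mderivD dehomogD IHf IHg.
by rewrite dehomogM !mderivM dehomogD !dehomogM IHf IHg.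
Qed.

Variable v : vfield k 3.
Hypothesis v_homog : forall j, v j \is 2.-homog.

Lemma derivation_homog f d : f \is d.-homog -> derivation v f \is d.+1.-homog.
Proof.
move=> fd; apply: rpred_sum => j _; case: d fd => [|d] fd.
  by rewrite (homog0_const fd) mderivC mulr0 rpred0.
by rewrite (_ : d.+2 = 2 + d)%N //; apply: dhomogM => //; apply: (mderiv_homog j fd).
Qed.

(** The value of [v] on the quotient [x_(lift i l) / x_i], restricted to [x_i = 1]. *)
Definition chart_vfield : vfield k 2 :=
  fun l => pi (v (lift i l)) - 'X_l * pi (v i).

(** Euler's relation eliminates the derivative along [x_i], at the price of the term with multiplier
    [d]. As [v] raises degrees by one, iterating this produces exactly [twisted]. *)
Lemma dehomog_derivation f d : f \is d.-homog ->
  pi (derivation v f) = derivation chart_vfield (pi f) + pi (v i) * pi f *+ d.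
Proof.
move=> /euler/(congr1 pi); rewrite dehomog_sum dehomogMn (bigD1_ord i) //=.
rewrite dehomogM dehomogXi mul1r.
under eq_bigr => l _ do rewrite dehomogM dehomogXlift.
move=> /(canRL (addrK _)) eu; rewrite /derivation dehomog_sum (bigD1_ord i) //=.
rewrite dehomogM eu mulrBr mulrnAr addrC addrA addrAC; congr (_ + _).
rewrite [X in _ - X]mulr_sumr -sumrB; apply: eq_bigr => l _.
by rewrite dehomogM mderiv_dehomog /chart_vfield; ring.
Qed.

Lemma iter_derivation_homog f d m :
  f \is d.-homog -> iter m (derivation v) f \is (d + m).-homog.
Proof.
by move=> fd; elim: m => [|m IH]; rewrite ?addn0 // addnS; apply: derivation_homog.
Qed.

Lemma dehomog_iter_derivation f d m : f \is d.-homog ->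
  pi (iter m (derivation v) f) = twisted (derivation chart_vfield) (pi (v i)) d m (pi f).
Proof.
move=> fd; elim: m => //= m IH.
by rewrite (dehomog_derivation (iter_derivation_homog m fd)) IH.
Qed.

Variables (p : nat) (w : form1 k 3).
Hypothesis charp : p \in [pchar k].
Hypothesis w_euler : \sum_(j < 3) 'X_j * w j = 0.
Hypothesis vw0 : contraction v w = 0.

Lemma derivation_is_derivation n (u : vfield k n) : is_derivation (derivation u).
Proof. by split; [exact: derivationD | exact: derivationM]. Qed.

(** On [x_i = 1] the Euler relation expresses [w i] through the other two coefficients; substituting
    it into [v w = 0] gives the claim. *)
Lemma contraction_chart : contraction chart_vfield (chart_form i w) = 0.
Proof.
have := congr1 pi w_euler; rewrite dehomog_sum (bigD1_ord i) //= dehomogM dehomogXi.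
rewrite mul1r dehomog0 => eu.
have := congr1 pi vw0; rewrite /contraction dehomog_sum (bigD1_ord i) //= dehomogM.
rewrite dehomog0 => e0; rewrite -[RHS]e0.
have /(canRL (addrK _)) -> := eu; rewrite sub0r mulrN mulr_sumr addrC -sumrB.
apply: eq_bigr => l _.
by rewrite /chart_vfield /chart_form !dehomogM dehomogXlift; ring.
Qed.

(** On the chart [v^p x_j] is a twisted iterate of weight 1. Splitting [x_j = x_j * 1] with weights
    0 and 1 yields the iterate of [D], Hochschild's correction [c * D], and [x_j] times a factor
    independent of [j]. The correction is killed by [contraction_chart], the last term by the Euler
    relation of [w]. *)
Lemma contraction_vpow_chart :
  contraction (vpow p chart_vfield) (chart_form i w) = pi (contraction (vpow p v) w).
Proof.
have charp2 : p \in [pchar {mpoly k[2]}].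
  by rewrite inE (pcharf_prime charp) -mpolyC_nat (pcharf0 charp) mpolyC0 eqxx.
pose D := derivation chart_vfield; pose K := pi (v i).
have derD : is_derivation D by exact: derivation_is_derivation.
have [c cE] := hochschild K derD charp2.
have VE j : pi (vpow p v j) =
    iter p D (pi 'X_j) + c * D (pi 'X_j) + pi 'X_j * twisted D K 1 p 1.
  rewrite /vpow (@dehomog_iter_derivation _ 1) ?dhomogX /= ?mdeg1 //.
  by rewrite -{1}[pi 'X_j]mulr1 (twisted_char K derD charp2 0 1) cE mulr1.
have it1 : iter p D 1 = 0.
  case: p charp => [/pcharf_prime//|q _]; rewrite iterSr /D derivation1.
  by elim: q => //= q ->; rewrite derivation0.
rewrite /contraction dehomog_sum.
transitivity (\sum_(j < 3) (iter p D (pi 'X_j) + c * D (pi 'X_j)) * pi (w j)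
   + twisted D K 1 p 1 * \sum_(j < 3) pi ('X_j * w j)); last first.
  rewrite mulr_sumr -big_split; apply: eq_bigr => j _ /=.
  by rewrite !dehomogM VE; ring.
rewrite -dehomog_sum w_euler dehomog0 mulr0 addr0.
rewrite (bigD1_ord i) //= dehomogXi it1 /D derivation1 mulr0 addr0 mul0r add0r.
under [RHS]eq_bigr => l _ do rewrite dehomogXlift derivationX mulrDl.
rewrite big_split /=.
have -> : \sum_(l < 2) c * chart_vfield l * pi (w (lift i l)) =
    c * contraction chart_vfield (chart_form i w).
  by rewrite mulr_sumr; apply: eq_bigr => l _; rewrite mulrA.
by rewrite contraction_chart mulr0 addr0.
Qed.

End Charts.

Lemma vpow_scale (k : fieldType) n p (c : k) (v w : vfield k n) :
  (forall j, w j = c *: v j) -> forall j, vpow p w j = c ^+ p *: vpow p v j.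
Proof.
move=> wv j; rewrite /vpow; elim: p => [|p IH]; first by rewrite scale1r.
rewrite !iterS IH derivationZ exprSr -scalerA; congr (_ *: _).
by rewrite /derivation scaler_sumr; apply: eq_bigr => l _; rewrite wv scalerAl.
Qed.

(** * The homogeneous Jouanolou field *)

Lemma sum3 (V : nmodType) (F : 'I_3 -> V) : \sum_(i < 3) F i = F 0 + F 1 + F 2%R.
Proof.
rewrite !big_ord_recl big_ord0 addr0 addrA.
by congr (F _ + F _ + F _); apply/val_inj.
Qed.

Lemma ord3_ind (P : 'I_3 -> Prop) : P 0 -> P 1 -> P 2%R -> forall i, P i.
Proof.
move=> P0 P1 P2 [[|[|[|j]]] lt_j] //.
- by rewrite (_ : Ordinal lt_j = 0) //; apply/val_inj.
- by rewrite (_ : Ordinal lt_j = 1) //; apply/val_inj.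
by rewrite (_ : Ordinal lt_j = 2%R) //; apply/val_inj.
Qed.

Section JouanolouField.

Variables (k : closedFieldType).

Local Notation x := ('X_0 : {mpoly k[3]}).
Local Notation y := ('X_1 : {mpoly k[3]}).
Local Notation z := ('X_2%R : {mpoly k[3]}).
Local Notation w := (jouanolou_form k 2).

Definition jouanolou_field : vfield k 3 := fun i => [:: z ^+ 2; x ^+ 2; y ^+ 2]`_i.

Local Notation v := jouanolou_field.

Lemma contraction_jouanolou : contraction v w = 0.
Proof. by rewrite /contraction sum3 /v /w /=; ring. Qed.

Lemma jouanolou_field_homog j : v j \is 2.-homog.
Proof.
have hX (i : 'I_3) : ('X_i ^+ 2 : {mpoly k[3]}) \is 2.-homog.
  by apply: (@dhomogMn _ _ _ 1 _ 2); rewrite dhomogX /= mdeg1.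
by elim/ord3_ind: j; apply: hX.
Qed.

Variable p : nat.
Hypothesis charp : p \in [pchar k].

Definition jouanolou_pform : {mpoly k[3]} := contraction (vpow p v) w.

Local Notation F := jouanolou_pform.

(** Ties the field of the standard local model to [v]. The constant is a sign, which comes from the
    order in which [lift i] lists the other two coordinates. *)
Lemma dual_chart_vfield (i : 'I_3) : exists2 c : k, c != 0 &
  forall l, dual_vfield (chart_form i w) l = c *: chart_vfield i v l.
Proof.
have two (P : 'I_2 -> Prop) : P 0 -> P 1 -> forall l, P l.
  move=> P0 P1 [[|[|l]] lt_l] //.
    by rewrite (_ : Ordinal lt_l = 0) //; apply/val_inj.
  by rewrite (_ : Ordinal lt_l = 1) //; apply/val_inj.
have E l (j : 'I_3) : lift i l = j -> chart_form i w l = dehomog i (w j) by move=> <-.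
have E' l (j : 'I_3) : lift i l = j ->
  chart_vfield i v l = dehomog i (v j) - 'X_l * dehomog i (v i) by move=> <-.
have dB f g : dehomog i (f - g) = dehomog i f - dehomog i g by exact: rmorphB.
have dX f m : dehomog i (f ^+ m) = dehomog i f ^+ m by exact: rmorphXn.
have L l (j : 'I_3) : lift i l = j -> dehomog i 'X_j = 'X_l :> {mpoly k[2]}.
  by move=> <-; rewrite dehomogXlift.
have M := dehomogXi k i.
elim/ord3_ind: i E E' dB dX L M => E E' dB dX L M.
- exists (-1); first by rewrite oppr_eq0 oner_eq0.
  have l0 : lift 0 (0 : 'I_2) = 1 :> 'I_3 by exact/val_inj.
  have l1 : lift 0 (1 : 'I_2) = 2%R :> 'I_3 by exact/val_inj.
  apply: two; rewrite /dual_vfield /= scaleN1r.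
    rewrite (E _ _ l1) (E' _ _ l0) /= !(dB, dehomogM, dX) M (L _ _ l0) (L _ _ l1).
    by ring.
  rewrite (E _ _ l0) (E' _ _ l1) /= !(dB, dehomogM, dX) M (L _ _ l0) (L _ _ l1).
  by ring.
- exists 1; first by rewrite oner_eq0.
  have l0 : lift 1 (0 : 'I_2) = 0 :> 'I_3 by exact/val_inj.
  have l1 : lift 1 (1 : 'I_2) = 2%R :> 'I_3 by exact/val_inj.
  apply: two; rewrite /dual_vfield /= scale1r.
    rewrite (E _ _ l1) (E' _ _ l0) /= !(dB, dehomogM, dX) M (L _ _ l0) (L _ _ l1).
    by ring.
  rewrite (E _ _ l0) (E' _ _ l1) /= !(dB, dehomogM, dX) M (L _ _ l0) (L _ _ l1).
  by ring.
exists (-1); first by rewrite oppr_eq0 oner_eq0.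
have l0 : lift 2%R (0 : 'I_2) = 0 :> 'I_3 by exact/val_inj.
have l1 : lift 2%R (1 : 'I_2) = 1 :> 'I_3 by exact/val_inj.
apply: two; rewrite /dual_vfield /= scaleN1r.
  rewrite (E _ _ l1) (E' _ _ l0) /= !(dB, dehomogM, dX) M (L _ _ l0) (L _ _ l1).
  by ring.
rewrite (E _ _ l0) (E' _ _ l1) /= !(dB, dehomogM, dX) M (L _ _ l0) (L _ _ l1).
by ring.
Qed.

Lemma p_divisor_jouanolou : same_divisor (p_divisor p (jouanolou k 2)) (curve F).
Proof.
move=> i; have [c c0 wc] := dual_chart_vfield i.
exists (c ^+ p); first exact: expf_neq0.
rewrite /p_divisor /= /curve -(contraction_vpow_chart i jouanolou_field_homog charp).
- rewrite /contraction scaler_sumr; apply: eq_bigr => l _.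
  by rewrite (vpow_scale p wc) scalerAl.
- exact: jouanolou_euler.
exact: contraction_jouanolou.
Qed.

Lemma derivation_jouanolou_pform : derivation v F = 0.
Proof.
pose V := vpow p v.
(* The derivation given by [V] is the [p]-th iterate of [v], so the two commute. *)
have vV j : derivation v (V j) = derivation V (v j).
  by rewrite (derivation_vpow _ _ charp) -(derivationX v j) -iterS iterSr.
have DX n (u : vfield k n) f m :
    derivation u (f ^+ m.+1) = f ^+ m * derivation u f *+ m.+1.
  elim: m => [|m IH]; first by rewrite expr1 expr0 mul1r.
  by rewrite exprS derivationM IH exprS; ring.
have DB n (u : vfield k n) f g : derivation u (f - g) = derivation u f - derivation u g.
  by rewrite derivationD -scaleN1r derivationZ scaleN1r.
(* What remains is a polynomial identity in arbitrary values [V j]: the Lie derivative of [w] along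
   [v] is zero. *)
rewrite /F /contraction -/V sum3 !derivationD !derivationM !vV /= !(DB, derivationM, DX).
by rewrite !derivationX /v /jouanolou_form /=; ring.
Qed.

Lemma jouanolou_pform_homog : F \is (p + 4).-homog.
Proof.
apply: rpred_sum => i _; rewrite (_ : p + 4 = 1 + p + 3)%N; last by rewrite addnAC addnC.
apply: dhomogM; last exact: jouanolou_homog.
by apply: (iter_derivation_homog jouanolou_field_homog); rewrite dhomogX /= mdeg1.
Qed.

End JouanolouField.

(** * The singular point (1 : 1 : 1) *)

(** The elements of the prime field are the [p] distinct roots of the right-hand side. *)
Lemma prod_XaddC_natr (k : fieldType) p : p \in [pchar k] ->
  \prod_(m < p) ('X + (m%:R)%:P) = 'X^p - 'X :> {poly k}.
Proof.
move=> charp; have p_pr := pcharf_prime charp; have p2 := prime_gt1 p_pr.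
pose rs : seq k := [seq - m%:R | m <- iota 0 p].
have sz : size ('X^p - 'X : {poly k}) = p.+1.
  by rewrite size_polyDl ?size_polyXn // size_polyN size_polyX ltnS.
have mon : lead_coef ('X^p - 'X : {poly k}) = 1.
  by rewrite lead_coefDl ?lead_coefXn // size_polyXn size_polyN size_polyX ltnS.
rewrite (@all_roots_prod_XsubC _ ('X^p - 'X) rs).
- rewrite mon scale1r big_map -[in RHS](subn0 p) big_mkord.
  by apply: eq_bigr => m _; rewrite polyCN opprK.
- by rewrite sz size_map size_iota.
- apply/allP => _ /mapP[m _ ->]; rewrite rootE !hornerE.
  rewrite -(pFrobenius_autE charp) pFrobenius_autN pFrobenius_aut_nat.
  by rewrite subrr.
rewrite uniq_rootsE map_inj_in_uniq ?iota_uniq // => m1 m2.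
rewrite !mem_iota !add0n /= => lt1 lt2 /oppr_inj.
wlog le12 : m1 m2 lt1 lt2 / (m1 <= m2)%N.
  by move=> h; case: (leqP m1 m2) => [|/ltnW] le e; [|apply/esym]; apply: h.
move=> e; have : (p %| m2 - m1)%N by rewrite (dvdn_pcharf charp) natrB // e subrr.
by have [|d0] := posnP (m2 - m1); [lia | rewrite gtnNdvd //; lia].
Qed.

Lemma mderiv_sum n (R : comNzRingType) i (I : Type) (r : seq I) (F : I -> {mpoly R[n]}) :
  mderiv i (\sum_(j <- r) F j) = \sum_(j <- r) mderiv i (F j).
Proof. exact: linear_sum. Qed.

Lemma meval_sum n (R : comNzRingType) (P : 'I_n -> R) (I : Type) (r : seq I)
    (F : I -> {mpoly R[n]}) :
  (\sum_(j <- r) F j).@[P] = \sum_(j <- r) (F j).@[P].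
Proof. exact: rmorph_sum. Qed.

Section SingularPoint.

Variables (k : closedFieldType) (p : nat).
Hypothesis charp : p \in [pchar k].
Hypothesis p_odd : (2 < p)%N.
Hypothesis p_mod3 : p = 2 %[mod 3].
Implicit Types f g : {mpoly k[3]}.

Local Notation v := (jouanolou_field k).
Local Notation F := (jouanolou_pform k p).
Local Notation ev := (meval (fun _ : 'I_3 => 1 : k)).

Let p_pr := pcharf_prime charp.

Let natr_small m : (0 < m < p)%N -> m%:R != 0 :> k.
Proof. by case/andP=> m0 mp; rewrite -(dvdn_pcharf charp) gtnNdvd. Qed.

Let two0 : 2%:R != 0 :> k. Proof. exact: natr_small. Qed.

Let three0 : 3%:R != 0 :> k.
Proof. by rewrite -(dvdn_pcharf charp) dvdn_prime2 //; apply/eqP=> e; move: p_mod3; rewrite e. Qed.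

Lemma ev_v j : ev (v j) = 1.
Proof. by elim/ord3_ind: j; rewrite /= rmorphXn /= mevalXU expr1n. Qed.

Lemma ev_euler f d : f \is d.-homog -> \sum_i ev (mderiv i f) = ev f *+ d.
Proof.
move/euler/(congr1 ev); rewrite meval_sum rmorphMn /= => <-.
by apply: eq_bigr => i _; rewrite rmorphM /= mevalXU mul1r.
Qed.

Lemma ev_derivation f d : f \is d.-homog -> ev (derivation v f) = ev f *+ d.
Proof.
move/ev_euler <-; rewrite /derivation meval_sum; apply: eq_bigr => i _.
by rewrite rmorphM /= ev_v mul1r.
Qed.

(** At [(1 : 1 : 1)] the field is radial, so the second derivatives of [f] add up by Euler's
    relation for [mderiv b f]. Only [v (b + 1)], indices modulo 3, involves the variable [b], with
    derivative 2. *)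
Lemma ev_mderiv_derivation f d b : f \is d.+1.-homog ->
  ev (mderiv b (derivation v f)) = ev (mderiv (b + 1) f) *+ 2 + ev (mderiv b f) *+ d.
Proof.
move=> fd; rewrite /derivation mderiv_sum meval_sum /=.
under eq_bigr => j _ do rewrite mderivM rmorphD !rmorphM /= ev_v mul1r mderiv_comm.
rewrite big_split /= (ev_euler (mderiv_homog b fd)) /=; congr (_ + _).
rewrite sum3 /=.
have DX (i j : 'I_3) : ev (mderiv i ('X_j ^+ 2)) = (i == j)%:R *+ 2.
  by rewrite expr2 mderivM rmorphD !rmorphM /= mderivXU mevalXU rmorph_nat; ring.
rewrite !DX; elim/ord3_ind: b => /=; rewrite ?(mul0rn, mul0r, add0r, addr0) mulr_natl.
- by congr (ev (mderiv _ _) *+ 2); apply/val_inj.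
- by congr (ev (mderiv _ _) *+ 2); apply/val_inj.
by congr (ev (mderiv _ _) *+ 2); apply/val_inj.
Qed.

(** The gradient satisfies [a (b + 1) = r * a b] with [r = -s/2] in the prime field, and its entries
    sum to zero. If it is nonzero, then [1 + r + r^2 = 0], so [r] is a primitive cube root of unity;
    the prime field has none when [p = 2] modulo 3. *)
Lemma singular_factor f d : f \is d.-homog -> derivation v f = 0 -> d%:R != 0 :> k ->
  ev f = 0 /\ forall i, ev (mderiv i f) = 0.
Proof.
case: d => [|d]; first by rewrite eqxx.
move=> fd vf0 d0; have f0 : ev f = 0.
  have := ev_derivation fd; rewrite vf0 meval0 => /esym/eqP.
  by rewrite -mulr_natr mulf_eq0 (negbTE d0) orbF => /eqP.
split=> //; pose a i := ev (mderiv i f); pose s : k := d%:R.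
have rel b : 2 * a (b + 1) + s * a b = 0.
  by rewrite !mulr_natl -(ev_mderiv_derivation _ fd) vf0 mderiv0 meval0.
have e0 : 2 * a 1 + s * a 0 = 0.
  by have := rel 0; rewrite add0r.
have e1 : 2 * a 2%R + s * a 1 = 0.
  by have := rel 1; rewrite (_ : 1 + 1 = 2%R) //; apply/val_inj.
have e2 : 2 * a 0 + s * a 2%R = 0.
  by have := rel 2%R; rewrite (_ : 2%R + 1 = 0) //; apply/val_inj.
have sum0 : a 0 + a 1 + a 2%R = 0 by rewrite -sum3 (ev_euler fd) f0 mul0rn.
have [a0|a0] := eqVneq (a 0) 0.
  have a1 : a 1 = 0.
    by move/eqP: e0; rewrite a0 mulr0 addr0 mulf_eq0 (negbTE two0) => /eqP.
  have a2 : a 2%R = 0.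
    by move/eqP: e1; rewrite a1 mulr0 addr0 mulf_eq0 (negbTE two0) => /eqP.
  by elim/ord3_ind.
(* This is [1 + r + r^2 = 0] multiplied by 4. *)
have s0 : s ^+ 2 - 2 * s + 4 = 0.
  apply: (mulIf a0); rewrite mul0r.
  have -> : (s ^+ 2 - 2 * s + 4) * a 0 = 4 * (a 0 + a 1 + a 2%R)
     - 2 * (2 * a 2%R + s * a 1) + (s - 2) * (2 * a 1 + s * a 0) by ring.
  by rewrite sum0 e0 e1 !mulr0 subr0 addr0.
have s3 : s ^+ 3 = - 8.
  have : s ^+ 3 + 8 = (s + 2) * (s ^+ 2 - 2 * s + 4) by ring.
  by rewrite s0 mulr0 => /eqP; rewrite addr_eq0 => /eqP.
have pE : p = (p %/ 3 * 3 + 2)%N by rewrite {1}(divn_eq p 3) p_mod3.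
set q := (p %/ 3)%N in pE.
have sp : s ^+ p = s by rewrite -(pFrobenius_autE charp) pFrobenius_aut_nat.
have tp : (-2) ^+ p = -2 :> k.
  by rewrite -(pFrobenius_autE charp) pFrobenius_autN pFrobenius_aut_nat.
have snz : s != 0.
  apply/eqP => e; move/eqP: s0; rewrite e expr0n mulr0 subrr add0r.
  by rewrite (_ : 4 = 2 * 2) ?mulf_eq0 ?(negbTE two0) //; ring.
(* Since [s] and [-2] are both fixed by Frobenius and have the same cube, writing [p = 3 q + 2]
   forces [s = -2], whence [12 = 0]. *)
move: sp tp; rewrite pE !exprD ![_ ^+ (q * 3)]exprM ![_ ^+ q ^+ 3]exprAC s3.
have -> : (-2) ^+ 3 = -8 :> k by ring.
set u := (-8) ^+ q => sp tp.
have us : u * s = 1 by apply: (mulIf snz); rewrite mul1r -mulrA -expr2.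
have u2 : 2 * u = -1.
  apply: (mulfI two0); have -> : 2%:R * (2 * u) = u * (-2) ^+ 2 by ring.
  by rewrite tp; ring.
have s2 : s = -2.
  have -> : s = - ((-1) * s) by ring.
  by rewrite -u2 -mulrA us mulr1.
move/eqP: s0; rewrite s2 (_ : _ + _ = 2%:R * 2%:R * 3%:R); last by ring.
by rewrite !mulf_eq0 (negbTE two0) (negbTE three0).
Qed.

Lemma iter_derivationX_homog i m : iter m (derivation v) 'X_i \is m.+1.-homog.
Proof.
have X1 : ('X_i : {mpoly k[3]}) \is 1.-homog by rewrite dhomogX /= mdeg1.
by have := iter_derivation_homog (@jouanolou_field_homog k) m X1; rewrite add1n.
Qed.

(** The linear part of [v] at the singular point, acting on gradients written as rows. *)
Let N : 'M[k]_3 := \matrix_(j, b) ((j == b + 1)%:R *+ 2).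

(** The [m]-th iterate has degree [m + 1], so by [ev_mderiv_derivation] the next application of [v]
    multiplies its gradient by [N + m]. For [n = p] the product is [N^p - N]. *)
Lemma grad_iter i n : \row_b ev (mderiv b (iter n (derivation v) 'X_i)) =
  delta_mx 0 i *m horner_mx N (\prod_(m < n) ('X + (m%:R)%:P)).
Proof.
elim: n => [|n IH].
  rewrite big_ord0 rmorph1 mulmx1; apply/rowP => b.
  by rewrite !mxE /= mderivXU rmorph_nat eq_sym.
rewrite big_ord_recr rmorphM mulmxA -IH rmorphD /= horner_mx_X horner_mx_C.
rewrite mulmxDr mul_mx_scalar; apply/rowP => b; rewrite !mxE /=.
rewrite (@ev_mderiv_derivation _ n); last first.
  exact: iter_derivationX_homog.
rewrite mulr_natl; congr (_ + _); rewrite (bigD1 (b + 1)) //= big1 => [|j ne].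
  by rewrite !mxE eqxx addr0 mulr_natr.
by rewrite !mxE (negbTE ne) mul0rn mulr0.
Qed.

Lemma grad_vpow i b : ev (mderiv b (vpow p v i)) =
  (i == b + 1 + 1)%:R *+ 2 - (i == b + 1)%:R *+ 2.
Proof.
have := grad_iter i p; rewrite (prod_XaddC_natr charp) => /rowP/(_ b).
rewrite mxE => ->; rewrite rmorphB rmorphXn /= horner_mx_X.
have rN (u : 'rV[k]_3) c : (u *m N) 0 c = u 0 (c + 1) *+ 2.
  rewrite mxE (bigD1 (c + 1)) //= big1 => [|j ne].
    by rewrite !mxE eqxx addr0 mulr_natr.
  by rewrite !mxE (negbTE ne) mul0rn mulr0.
have N3 : N ^+ 3 = 8%:R%:M.
  apply/row_matrixP => j; rewrite !rowE; apply/rowP => c.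
  rewrite exprS exprS expr1 !mulmxA !rN mul_mx_scalar !mxE eqxx.
  have -> : c + 1 + 1 + 1 = c by elim/ord3_ind: c; apply/val_inj.
  by case: eqP => _; ring.
have pE : p = (p %/ 3 * 3 + 2)%N by rewrite {1}(divn_eq p 3) p_mod3.
set q := (p %/ 3)%N in pE.
(* As [N^3 = 8] and [p = 3 q + 2], [N^p] is [8^q N^2]; the identity [2^p = 2] evaluates the
   constant. *)
have q4 : 8 ^+ q * 4 = 2 :> k.
  transitivity (2%:R ^+ p : k); last by rewrite -(pFrobenius_autE charp) pFrobenius_aut_nat.
  rewrite pE exprD exprM exprAC; have -> : 2%:R ^+ 3 = 8 :> k by ring.
  by ring.
have -> : N ^+ p = (8 ^+ q) *: N ^+ 2.
  by rewrite pE exprD exprM exprAC N3 -rmorphXn -[LHS]/(_ *m _) mul_scalar_mx.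
rewrite mulmxBr -scalemxAr expr2 mulmxA; set d := delta_mx 0 i.
transitivity (8 ^+ q * (d *m N *m N) 0 b - (d *m N) 0 b); first by rewrite !mxE.
rewrite !rN !mxE eqxx /= ![i == _]eq_sym.
by rewrite -mulrnA -[_ *+ (2 * 2)]mulr_natl mulrA q4 mulr_natl.
Qed.

(** The last of the [p] derivations is applied to a form of degree [p], so [ev_derivation]
    contributes the factor [p]. *)
Lemma ev_vpow i : ev (vpow p v i) = 0.
Proof.
have -> : vpow p v i = derivation v (iter p.-1 (derivation v) 'X_i).
  by rewrite -iterS prednK ?prime_gt0.
rewrite (@ev_derivation _ p); first by rewrite -mulr_natr (pcharf0 charp) mulr0.
by have := iter_derivationX_homog i p.-1; rewrite prednK ?prime_gt0.
Qed.

(** Both [v^p] and [w] vanish at the point, so only products of first derivatives survive. The value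
    is [-16]. *)
Lemma hessian_jouanolou_pform : ev (mderiv 0 (mderiv 0 F)) != 0.
Proof.
have w0 i : ev (jouanolou_form k 2 i) = 0.
  by elim/ord3_ind: i; rewrite /= !(rmorphB, rmorphM, rmorphXn) /= !mevalXU; ring.
have Dw i : ev (mderiv 0 (jouanolou_form k 2 i)) = [:: 2; 1; -3]`_i.
  elim/ord3_ind: i => /=; rewrite mderivB !mderivM !mderivXU /=;
  rewrite !(rmorphB, rmorphM, rmorphXn, rmorphD, rmorphMn, rmorph1, rmorph0) /= !mevalXU; ring.
have -> : ev (mderiv 0 (mderiv 0 F)) =
    2 * \sum_i ev (mderiv 0 (vpow p v i)) * ev (mderiv 0 (jouanolou_form k 2 i)).
  have -> : mderiv 0 F = \sum_i mderiv 0 (vpow p v i * jouanolou_form k 2 i).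
    exact: mderiv_sum.
  rewrite mderiv_sum meval_sum mulr_sumr.
  apply: eq_bigr => i _; rewrite !(mderivM, mderivD) !rmorphD !rmorphM /= w0 ev_vpow.
  ring.
rewrite sum3 !grad_vpow !Dw /= (_ : _ * _ = - (2%:R * 2%:R * 2%:R * 2%:R)).
  by rewrite oppr_eq0 !mulf_neq0.
ring.
Qed.

End SingularPoint.

(** * Quartic first integrals *)

Section Quartics.

Variable k : closedFieldType.
Implicit Types f g h : {mpoly k[3]}.

Local Notation v := (jouanolou_field k).

Let mono (a b c : nat) : 'X_{1..3} := [multinom nth 0%N [:: a; b; c] i | i < 3].

Lemma mcoeff_sqrXM (n : nat) (R : comNzRingType) (f : {mpoly R[n]}) j m :
  ('X_j ^+ 2 * f)@_m = if (1 < m j)%N then f@_(m - U_(j) *+ 2) else 0.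
Proof.
rewrite mulrC mpolyXn; case: ltnP => [m2|m2].
  rewrite -{1}(@submK _ (U_(j) *+ 2)%MM m) 1?addmC ?mcoeffMX //.
  apply/mnm_lepP => i; rewrite mulmnE mnm1E; case: eqP => [<-|_] /=; first lia.
  by rewrite ?muln0 ?mul0n.
apply: memN_msupp_eq0; rewrite (perm_mem (msuppMX _ _)).
apply/mapP => -[m' _ em]; move: m2; rewrite em mnmDE mulmnE mnm1E eqxx ?mul1n ?muln1.
by rewrite ltnNge /=; lia.
Qed.

Lemma mcoeff_jouanolou_derivation h a b c : (derivation v h)@_(mono a b c) =
  (if (1 < c)%N then h@_(mono a.+1 b (c - 2)) *+ a.+1 else 0) +
  (if (1 < a)%N then h@_(mono (a - 2) b.+1 c) *+ b.+1 else 0) +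
  (if (1 < b)%N then h@_(mono a (b - 2) c.+1) *+ c.+1 else 0).
Proof.
rewrite /derivation sum3 !mcoeffD /= !mcoeff_sqrXM !mcoeff_mderiv /=.
have mE (m : 'X_{1..3}) a' b' c' : m 0 = a' -> m 1 = b' -> m 2%R = c' ->
    m = mono a' b' c'.
  by move=> m0 m1 m2; apply/mnmP; elim/ord3_ind; rewrite mnmE.
have mc a' b' c' (j : 'I_3) : mono a' b' c' j = nth 0%N [:: a'; b'; c'] j by rewrite mnmE.
rewrite !mc /=; congr (_ + _ + _); case: ifP => // gt1.
- have -> : (mono a b c - U_(2%R) *+ 2 + U_(0%R))%MM = mono a.+1 b (c - 2).
    by apply: mE; rewrite mnmDE mnmBE mulmnE !mnm1E mc /=; lia.
  by rewrite mnmBE mulmnE mnm1E mc /= ?muln0 ?mul0n subn0.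
- have -> : (mono a b c - U_(0%R) *+ 2 + U_(1%R))%MM = mono (a - 2) b.+1 c.
    by apply: mE; rewrite mnmDE mnmBE mulmnE !mnm1E mc /=; lia.
  by rewrite mnmBE mulmnE mnm1E mc /= ?muln0 ?mul0n subn0.
have -> : (mono a b c - U_(1%R) *+ 2 + U_(2%R))%MM = mono a (b - 2) c.+1.
  by apply: mE; rewrite mnmDE mnmBE mulmnE !mnm1E mc /=; lia.
by rewrite mnmBE mulmnE mnm1E mc /= ?muln0 ?mul0n subn0.
Qed.

(** The coefficients of the quintic [v h] are compared. Twelve coefficients of [h] vanish in turn;
    the three in the cyclic orbit of [C 1 3 0] are left in a linear system. *)
Lemma quartic_coefs (C : nat -> nat -> nat -> k) :
  2%:R != 0 :> k -> 7%:R != 0 :> k ->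
  (forall a b c,
    (if (1 < c)%N then C a.+1 b (c - 2)%N *+ a.+1 else 0) +
    (if (1 < a)%N then C (a - 2)%N b.+1 c *+ b.+1 else 0) +
    (if (1 < b)%N then C a (b - 2)%N c.+1 *+ c.+1 else 0) = 0) ->
  forall a b c, (a + b + c = 4)%N -> C a b c = 0.
Proof.
move=> two0 seven0 E.
have c310 : C 3 1 0 = 0 by have := E 5 0 0; rewrite /= !(add0r, addr0).
have c031 : C 0 3 1 = 0 by have := E 0 5 0; rewrite /= !(add0r, addr0).
have c103 : C 1 0 3 = 0 by have := E 0 0 5; rewrite /= !(add0r, addr0).
have reg2 (a : k) : a *+ 2 = 0 -> a = 0.
  by move/eqP; rewrite -mulr_natr mulf_eq0 (negbTE two0) orbF => /eqP.
have c220 : C 2 2 0 = 0 by apply: reg2; have := E 4 1 0; rewrite /= !(add0r, addr0).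
have c022 : C 0 2 2 = 0 by apply: reg2; have := E 0 4 1; rewrite /= !(add0r, addr0).
have c202 : C 2 0 2 = 0 by apply: reg2; have := E 1 0 4; rewrite /= !(add0r, addr0).
have c211 : C 2 1 1 = 0 by have := E 4 0 1; rewrite /= !(add0r, addr0).
have c121 : C 1 2 1 = 0 by have := E 1 4 0; rewrite /= !(add0r, addr0).
have c112 : C 1 1 2 = 0 by have := E 0 1 4; rewrite /= !(add0r, addr0).
have c400 : C 4 0 0 = 0.
  have := E 3 0 2; rewrite /= c112 !(add0r, addr0) (mulrnA _ 2 2).
  by move/reg2/reg2.
have c040 : C 0 4 0 = 0.
  have := E 2 3 0; rewrite /= c211 !(add0r, addr0) (mulrnA _ 2 2).
  by move/reg2/reg2.
have c004 : C 0 0 4 = 0.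
  have := E 0 2 3; rewrite /= c121 !(add0r, addr0) (mulrnA _ 2 2).
  by move/reg2/reg2.
have r1 : C 1 3 0 *+ 3 + C 3 0 1 = 0 by have := E 3 2 0; rewrite /= add0r.
have r2 : C 0 1 3 *+ 3 + C 1 3 0 = 0.
  by have := E 0 3 2; rewrite /= addr0 addrC.
have r3 : C 3 0 1 *+ 3 + C 0 1 3 = 0.
  by have := E 2 0 3; rewrite /= addr0.
have c130 : C 1 3 0 = 0.
  (* The system has determinant [28 = 2 * 2 * 7]. *)
  apply: (mulIf (mulf_neq0 two0 (mulf_neq0 two0 seven0))); rewrite mul0r.
  transitivity ((C 1 3 0 *+ 3 + C 3 0 1) *+ 9 - (C 3 0 1 *+ 3 + C 0 1 3) *+ 3
    + (C 0 1 3 *+ 3 + C 1 3 0)); first by ring.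
  by rewrite r1 r2 r3 !mul0rn subrr addr0.
have c301 : C 3 0 1 = 0 by move: r1; rewrite c130 mul0rn add0r.
have c013 : C 0 1 3 = 0 by move: r3; rewrite c301 mul0rn add0r.
move=> a b c abc; have -> : c = (4 - a - b)%N by lia.
have : (a + b <= 4)%N by lia.
by case: a {abc} => [|[|[|[|[|a]]]]]; case: b => [|[|[|[|[|b]]]]].
Qed.

Lemma quartic_first_integral h : 2%:R != 0 :> k -> 7%:R != 0 :> k ->
  h \is 4.-homog -> derivation v h = 0 -> h = 0.
Proof.
move=> two0 seven0 h4 vh; pose C a b c := h@_(mono a b c).
have C0 : forall a b c, (a + b + c = 4)%N -> C a b c = 0.
  apply: quartic_coefs => // a b c.
  by rewrite -mcoeff_jouanolou_derivation vh mcoeff0.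
apply/mpolyP => m; rewrite mcoeff0; have [m4|m4] := eqVneq (mdeg m) 4%N; last first.
  exact: (dhomog_nemf_coeff h4).
have -> : m = mono (m 0) (m 1) (m 2%R).
  by apply/mnmP; elim/ord3_ind; rewrite mnmE.
have em : (m 0%R + m 1%R + m 2%R = 4)%N by rewrite -m4 mdegE; exact/esym/(sum3 (V := nat)).
exact: C0.
Qed.

End Quartics.

(** * Diagonal symmetries *)

Section DiagonalAction.

Variables (k : fieldType) (n : nat) (wt : 'I_n -> nat).
Implicit Types (f g h : {mpoly k[n]}) (t u : k) (m : 'X_{1..n}).

Definition diag_act t : {mpoly k[n]} -> {mpoly k[n]} :=
  comp_mpoly [tuple t ^+ wt i *: 'X_i | i < n].

HB.instance Definition _ t := GRing.RMorphism.on (diag_act t).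
HB.instance Definition _ t := GRing.Linear.on (diag_act t).

Definition mweight_of m := (\sum_(i < n) wt i * m i)%N.

Lemma diag_actD t f g : diag_act t (f + g) = diag_act t f + diag_act t g.
Proof. exact: rmorphD. Qed.

Lemma diag_actM t f g : diag_act t (f * g) = diag_act t f * diag_act t g.
Proof. exact: rmorphM. Qed.

Lemma diag_actZ t c f : diag_act t (c *: f) = c *: diag_act t f.
Proof. exact: linearZ. Qed.

Lemma diag_actXU t i : diag_act t 'X_i = t ^+ wt i *: 'X_i.
Proof. by rewrite /diag_act comp_mpolyXU -tnth_nth tnth_mktuple. Qed.

Lemma mcoeff_diag_act t f m : (diag_act t f)@_m = t ^+ mweight_of m * f@_m.
Proof.
elim/mpolyind: f => [|c m' f _ _ IH]; first by rewrite rmorph0 mcoeff0 mulr0.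
rewrite diag_actD !mcoeffD IH mulrDr; congr (_ + _).
rewrite /diag_act comp_mpolyZ comp_mpolyX.
under eq_bigr => i _ do rewrite tnth_mktuple exprZn -exprM.
rewrite scaler_prod prodrXr -mpolyXE_id !mcoeffZ mcoeffX.
by case: eqP => [->|_]; rewrite ?mulr0 // !mulr1 mulrC.
Qed.

Lemma diag_act_homog t f d : f \is d.-homog -> diag_act t f \is d.-homog.
Proof.
move=> /dhomogP fd; apply/dhomogP => m; rewrite mcoeff_msupp mcoeff_diag_act => ne.
by apply: fd; rewrite mcoeff_msupp; apply: contraNneq ne => ->; rewrite mulr0.
Qed.

Lemma diag_act_comp t u f : diag_act t (diag_act u f) = diag_act (t * u) f.
Proof. by apply/mpolyP => m; rewrite !mcoeff_diag_act mulrA exprMn. Qed.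

Lemma diag_act1 f : diag_act 1 f = f.
Proof. by apply/mpolyP => m; rewrite mcoeff_diag_act expr1n mul1r. Qed.

Lemma diag_act_prime t f : t != 0 -> prime_elt f -> prime_elt (diag_act t f).
Proof.
move=> t0.
have VK : cancel (diag_act t^-1) (diag_act t).
  by move=> g; rewrite diag_act_comp mulfV // diag_act1.
have K : cancel (diag_act t) (diag_act t^-1).
  by move=> g; rewrite diag_act_comp mulVf // diag_act1.
exact: (@prime_elt_iso _ _ (diag_act t^-1) (diag_act t) f VK K).
Qed.

Lemma semi_invX t f c e : diag_act t f = c *: f -> diag_act (t ^+ e) f = c ^+ e *: f.
Proof.
move=> ef; elim: e => [|e IH]; first by rewrite diag_act1 scale1r.
by rewrite exprSr -diag_act_comp ef diag_actZ IH scalerA exprS.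
Qed.

Lemma semi_inv_neq0 t f c : t != 0 -> f != 0 -> diag_act t f = c *: f -> c != 0.
Proof.
move=> t0 f0 ef; apply: contraNneq f0 => c0; move: ef; rewrite c0 scale0r => ef.
by rewrite -[f]diag_act1 -(mulVf t0) -diag_act_comp ef rmorph0.
Qed.

(* The orbit of a prime factor is either a single divisor or consists of [l]
   distinct ones, whose product can be split off and has degree divisible by
   [l]. *)
Lemma semi_inv_prime_factor l t f c d : prime l -> t ^+ l = 1 ->
  f != 0 -> f \is d.-homog -> ~~ (l %| d)%N -> diag_act t f = c *: f ->
  exists g, [/\ prime_elt g, divides g f & exists c', diag_act t g = c' *: g].
Proof.
move=> l_pr tl; have l_gt0 := prime_gt0 l_pr.
have t0 : t != 0.
  by apply: contraTneq (oner_neq0 k) => t0; rewrite -tl t0 expr0n gtn_eqF // eqxx.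
elim/ltn_ind: d f c => d IH f c f0 fd ld ef.
have d0 : d != 0%N by apply: contraNneq ld => ->; rewrite dvdn0.
have fu : f \isn't a GRing.unit by rewrite (homog_unit f0 fd).
have [g gp [h efg]] := factorial_prime_divisor (@factorial_mpoly n k) f0 fu.
have [e ge] := homog_factor f0 fd efg.
have [g0 gu _] := gp.
have e0 : e != 0%N by rewrite (homog_unit g0 ge) in gu.
have [gI|gN] := classic (exists c', diag_act t g = c' *: g).
  by exists g; split=> //; exists h.
pose q i := diag_act (t ^+ i) g.
have qp i : prime_elt (q i) by apply: diag_act_prime => //; rewrite expf_neq0.
have qe i : q i \is e.-homog by apply: diag_act_homog.
have qn i j : (i < j < l)%N -> ~ divides (q i) (q j).
  case/andP=> ij jl [r er]; have [qj0 _ _] := qp j.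
  have [r0 rr0] := homog_factor qj0 (qe j) (etrans er (mulrC _ _)).
  have r00 : r0 = 0%N.
    have qr0 : q i * r != 0 by rewrite -er.
    have qre : q i * r \is e.-homog by rewrite -er.
    by have /eqP := homog_mulE qr0 qre (qe i) rr0; rewrite -{2}[e]addn0 eqn_add2l => /eqP.
  rewrite r00 in rr0; rewrite (homog0_const rr0) mulrC mul_mpolyC in er.
  have [m0 em] : exists m0 : nat, j = (i + m0)%N by exists (j - i)%N; rewrite subnKC // ltnW.
  have il : (i + (l - i) = l)%N by rewrite subnKC // ltnW // (ltn_trans ij).
  (* If [q i] divides [q j], the quotient is constant by degrees; acting by [t ^ (l - i)] makes [g]
     semi-invariant under [t ^ m0] with [m0 = j - i]. *)
  have egm : diag_act (t ^+ m0) g = r@_0 *: g.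
    move/(congr1 (diag_act (t ^+ (l - i)))): er.
    rewrite /q diag_actZ !diag_act_comp -!exprD em [(l - i + (i + m0))%N]addnA.
    by rewrite [(l - i + i)%N]addnC il exprD tl mul1r diag_act1.
  have m0_gt0 : (0 < m0)%N by rewrite em -{1}[i]addn0 ltn_add2l in ij.
  have lm0 : coprime m0 l.
    rewrite coprime_sym prime_coprime // gtnNdvd //.
    by rewrite em in jl; apply: leq_ltn_trans jl; apply: leq_addl.
  (* By Bezout [t] is a power of [t ^ m0], so [g] would be semi-invariant under [t] itself. *)
  case: (egcdnP l m0_gt0) => a b eab _; apply: gN; exists (r@_0 ^+ a).
  rewrite -(semi_invX a egm) -exprM mulnC eab (eqP lm0) addn1 exprSr mulnC exprM tl.
  by rewrite expr1n mul1r.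
have qf i : divides (q i) f.
  exists (c ^- i *: diag_act (t ^+ i) h); rewrite -scalerAr -diag_actM -efg.
  by rewrite (semi_invX i ef) scalerA mulVf ?scale1r // expf_neq0 // (semi_inv_neq0 t0 f0 ef).
have [f' ef'] : divides (\prod_(i < l) q i) f by apply: prime_family_dvd.
set N := \prod_(i < l) q i in ef'.
have Ne : N \is (l * e).-homog.
  rewrite /N; elim: (l) => [|l' IHl]; first by rewrite big_ord0 mul0n dhomog1.
  by rewrite big_ord_recr /= mulSnr; apply: dhomogM.
have N_inv : diag_act t N = N.
  have -> : diag_act t N = \prod_(i < l) diag_act t (q i) by exact: rmorph_prod.
  under eq_bigr => i _ do rewrite /q diag_act_comp -exprS.
  rewrite /N.
  case: l l_pr tl {l_gt0 IH ld qn N ef' Ne} => // l' _ tl.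
  by rewrite big_ord_recr big_ord_recl /= tl mulrC; congr (_ * _).
have N0 : N != 0 by apply: contraNneq f0 => e1; rewrite ef' e1 mul0r.
have f'0 : f' != 0 by apply: contraNneq f0 => e1; rewrite ef' e1 mulr0.
have [d' f'd] := homog_factor f0 fd (etrans ef' (mulrC _ _)).
have dE : (l * e + d' = d)%N.
  by apply: (@homog_mulE _ _ N f') => //; rewrite -ef'.
(* The cofactor has degree [d - l * e], still prime to [l], and is semi-invariant with the same [c]
   because [N] is invariant. *)
have [|||g' [g'p g'f' g'I]] := IH d' _ f' c f'0 f'd.
- by rewrite -dE -{1}[d']add0n ltn_add2r muln_gt0 l_gt0 lt0n.
- by rewrite -dE dvdn_addr ?dvdn_mulr in ld.
- apply: (mulfI N0); rewrite -{1}N_inv -diag_actM -ef' ef ef'.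
  by rewrite scalerAr.
by exists g'; split=> //; rewrite ef'; apply: dividesMl.
Qed.

End DiagonalAction.

(** * Irreducibility *)

Lemma max_power_divisor (k : fieldType) n (f g : {mpoly k[n]}) d e :
  f != 0 -> f \is d.-homog -> g \is e.-homog -> (0 < e)%N ->
  exists m h, f = g ^+ m * h /\ ~ divides g h.
Proof.
move=> f0 fd ge e0; elim/ltn_ind: d f f0 fd => d IH f f0 fd.
have [[h efh]|ng] := classic (divides g f); last by exists 0%N, f; rewrite mul1r.
have h0 : h != 0 by apply: contraNneq f0 => h0; rewrite efh h0 mulr0.
have [d' hd] := homog_factor f0 fd (etrans efh (mulrC _ _)).
have dE : (e + d' = d)%N by apply: (@homog_mulE _ _ g h) => //; rewrite -efh.
have [|m [h' [eh nh]]] := IH d' _ h h0 hd; first by rewrite -dE -{1}[d']add0n ltn_add2r.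
by exists m.+1, h'; rewrite exprS -mulrA -eh.
Qed.

Lemma derivationXn (k : fieldType) n (u : vfield k n) f m :
  derivation u (f ^+ m.+1) = f ^+ m * derivation u f *+ m.+1.
Proof.
elim: m => [|m IH]; first by rewrite expr1 expr0 mul1r.
by rewrite exprS derivationM IH exprS; ring.
Qed.

(** * The seventh roots of unity acting on the Jouanolou field *)

Section Symmetry.

Variables (k : closedFieldType) (t : k).
Hypothesis t7 : t ^+ 7 = 1.

Definition jouanolou_weight (i : 'I_3) : nat := nth 0%N [:: 0; 1; 3]%N i.

Local Notation v := (jouanolou_field k).
Local Notation w := (jouanolou_form k 2).
Local Notation sig := (diag_act jouanolou_weight t).

Let sigB f g : sig (f - g) = sig f - sig g. Proof. exact: rmorphB. Qed.
Let sigXn f m : sig (f ^+ m) = sig f ^+ m. Proof. exact: rmorphXn. Qed.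

Let T : {mpoly k[3]} := t%:MP.
Let TE m : (t ^+ m)%:MP = T ^+ m. Proof. exact: (rmorphXn (@mpolyC 3 k)). Qed.
Let T7 : T ^+ 7 = 1. Proof. by rewrite -TE t7 mpolyC1. Qed.

Let sigXU i : sig 'X_i = T ^+ jouanolou_weight i * 'X_i.
Proof. by rewrite diag_actXU -mul_mpolyC TE. Qed.

(** The field has weight [-1], written as 6: the weights 6, 0, 2 of [z^2], [x^2], [y^2] are those of
    [x], [y], [z] minus 1 modulo 7. *)
Lemma diag_act_field i :
  sig (v i) = t ^+ 6 *: (t ^+ jouanolou_weight i *: v i).
Proof.
rewrite -!mul_mpolyC !TE.
elim/ord3_ind: i; rewrite /v /= sigXn sigXU /jouanolou_weight /=; last first.
- transitivity (T ^+ 7 * (T ^+ 2 * 'X_1 ^+ 2)); first by rewrite T7; ring.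
  by ring.
- transitivity (T ^+ 7 * 'X_0 ^+ 2 : {mpoly k[3]}); first by rewrite T7; ring.
  by ring.
by ring.
Qed.

Lemma diag_act_derivation f : sig (derivation v f) = t ^+ 6 *: derivation v (sig f).
Proof.
elim/mpoly_ring_ind: f => [c|i|f g IHf IHg|f g IHf IHg].
- by rewrite /diag_act comp_mpolyC /derivation !big1 ?comp_mpoly0 ?scaler0 // => i _;
    rewrite mderivC mulr0.
- by rewrite derivationX diag_act_field diag_actXU derivationZ derivationX.
- by rewrite diag_actD !derivationD diag_actD IHf IHg scalerDr.
rewrite diag_actM !derivationM diag_actD !diag_actM IHf IHg scalerDr.
by rewrite scalerAl scalerAr.
Qed.

Lemma diag_act_pform p : exists c, sig (jouanolou_pform k p) = c *: jouanolou_pform k p.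
Proof.
have itE n i : sig (iter n (derivation v) 'X_i) =
    (t ^+ (6 * n) * t ^+ jouanolou_weight i) *: iter n (derivation v) 'X_i.
  elim: n => [|n IH]; first by rewrite diag_actXU muln0 mul1r.
  by rewrite /= diag_act_derivation IH derivationZ scalerA mulnS exprD !mulrA.
(* With [dx_i] carrying the weight of [x_i], the form [w] has weight 3 modulo 7. *)
have wE i : t ^+ jouanolou_weight i *: sig (w i) = t ^+ 3 *: w i.
  rewrite -!mul_mpolyC !TE.
  elim/ord3_ind: i; rewrite /jouanolou_form /= sigB !diag_actM ?sigXn !sigXU
    /jouanolou_weight /=.
  - by ring.
  - transitivity (T ^+ 3 * ('X_0 * 'X_1 ^+ 2 - T ^+ 7 * 'X_2%R ^+ 3) : {mpoly k[3]}).
      by ring.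
    by rewrite T7; ring.
  transitivity (T ^+ 3 * (T ^+ 7 * ('X_2%R ^+ 2 * 'X_1) - 'X_0 ^+ 3) : {mpoly k[3]}).
    by ring.
  by rewrite T7; ring.
exists (t ^+ (6 * p) * t ^+ 3).
rewrite /jouanolou_pform /contraction scaler_sumr.
have -> : sig (\sum_(i < 3) vpow p v i * w i) = \sum_(i < 3) sig (vpow p v i * w i).
  exact: rmorph_sum.
apply: eq_bigr => i _; rewrite diag_actM /vpow itE -scalerAl -[RHS]scalerA -[LHS]scalerA.
by congr (_ *: _); rewrite scalerAr wE -scalerAr.
Qed.

(** The weights 0, 1, 3 differ from 6 modulo 7, so a coordinate occurring in [l] would give [t^6],
    [t^5] or [t^3] equal to 1, hence [t = 1]. *)
Lemma diag_act_linear_eq0 l : t != 1 -> l \is 1.-homog ->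
  sig l = t ^+ 6 *: l -> l = 0.
Proof.
move=> t1 l1 el; apply/mpolyP => m; rewrite mcoeff0.
have [m1|m1] := eqVneq (mdeg m) 1%N; last exact: (dhomog_nemf_coeff l1).
have /mdeg1P[i /eqP em] : mdeg m == 1%N by rewrite m1.
have := congr1 (fun f : {mpoly k[3]} => f@_m) el; rewrite mcoeff_diag_act mcoeffZ => /eqP.
rewrite -subr_eq0 -mulrBl mulf_eq0 => /orP[|/eqP//].
have -> : mweight_of jouanolou_weight m = jouanolou_weight i.
  rewrite /mweight_of (bigD1 i) //= big1 => [|j ji]; rewrite em mnm1E.
    by rewrite eqxx muln1 addn0.
  by rewrite eq_sym (negbTE ji) muln0.
rewrite subr_eq0 => e; exfalso; move/eqP: t1; apply; move/eqP: e.
elim/ord3_ind: i {em} => /= e.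
- by rewrite -[RHS]t7 exprS -e mulr1.
- have e5 : t * (t ^+ 5) = t * 1 by rewrite mulr1 -exprS -e.
  have t0 : t != 0 by apply: contraTneq (oner_neq0 k) => t0; rewrite -t7 t0 expr0n eqxx.
  have {}e5 := mulfI t0 e5; transitivity ((t ^+ 5) ^+ 3 : k).
    by rewrite -exprM -[(5 * 3)%N]/(7 * 2 + 1)%N exprD exprM t7 expr1n mul1r.
  by rewrite e5 expr1n.
have t0 : t != 0 by apply: contraTneq (oner_neq0 k) => t0; rewrite -t7 t0 expr0n eqxx.
have e3 : t ^+ 3 * t ^+ 3 = t ^+ 3 * 1 by rewrite mulr1 -exprD -e.
have {}e3 := mulfI (expf_neq0 3 t0) e3.
by rewrite -[RHS]t7 -[7%N]/(3 * 2 + 1)%N exprD exprM e3 expr1n mul1r.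
Qed.

End Symmetry.

Section Irreducibility.

Variables (k : closedFieldType) (p : nat).
Hypothesis charp : p \in [pchar k].
Hypothesis p_gt4 : (4 < p)%N.
Hypothesis p_mod3 : p = 2 %[mod 3].
Hypothesis p_mod7 : ~~ (7 %| p + 4)%N.

Local Notation v := (jouanolou_field k).
Local Notation F := (jouanolou_pform k p).

Let p_pr := pcharf_prime charp.
Let p_gt2 : (2 < p)%N := ltn_trans (isT : 2 < 4)%N p_gt4.

Let two0 : 2%:R != 0 :> k.
Proof. by rewrite -(dvdn_pcharf charp) gtnNdvd. Qed.

Let seven0 : 7%:R != 0 :> k.
Proof.
by rewrite -(dvdn_pcharf charp) dvdn_prime2 //; apply/eqP => e; move: p_mod3; rewrite e.
Qed.

Lemma jouanolou_pform_neq0 : F != 0.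
Proof.
apply: contraNneq (hessian_jouanolou_pform charp p_gt2 p_mod3) => ->.
by rewrite !mderiv0 meval0.
Qed.

Lemma exists_unity7 : exists2 t : k, t ^+ 7 = 1 & t != 1.
Proof.
have sz : size (\poly_(i < 7) 1 : {poly k}) = 7%N by rewrite size_poly_eq ?oner_eq0.
have [t rt] : exists t : k, root (\poly_(i < 7) 1) t.
  by apply/closed_rootP; rewrite sz.
have ht : \sum_(i < 7) t ^+ i = 0.
  move/eqP: rt; rewrite horner_poly => e; rewrite -[RHS]e.
  by apply: eq_bigr => i _; rewrite mul1r.
exists t.
  apply/eqP; rewrite -subr_eq0; apply/eqP.
  have -> : t ^+ 7 - 1 = (t - 1) * \sum_(i < 7) t ^+ i.
    by rewrite !big_ord_recl big_ord0 /bump /=; ring.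
  by rewrite ht mulr0.
apply: contraNneq seven0 => t1; rewrite -ht t1.
by rewrite (eq_bigr (fun=> 1)) ?sumr_const ?card_ord // => i _; rewrite expr1n.
Qed.

Lemma first_integral_factor g h d e : F = g * h -> g \is d.-homog -> h \is e.-homog ->
  derivation v g = 0 -> derivation v h = 0 -> d = 0%N \/ e = 0%N.
Proof.
move=> eF gd he vg vh; have F0 := jouanolou_pform_neq0.
have Fh := jouanolou_pform_homog k p.
have deE : (d + e = p + 4)%N by apply: (@homog_mulE _ _ g h); rewrite -?eF.
have g0 : g != 0 by apply: contraNneq F0 => e0; rewrite eF e0 mul0r.
have h0 : h != 0 by apply: contraNneq F0 => e0; rewrite eF e0 mulr0.
have small n f : f != 0 -> f \is n.-homog -> derivation v f = 0 -> n != 4%N.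
  move=> f0 fn vf; apply: contraNneq f0 => n4; move: fn; rewrite n4 => fn.
  by rewrite (quartic_first_integral two0 seven0 fn vf).
(* Here [p > 4] enters: [2 p] exceeds [p + 4]. *)
have dvd n : (p %| n)%N -> (n <= p + 4)%N -> n = 0%N \/ n = p.
  case/dvdnP => -[|[|q]] -> le_n; [by left | by right; rewrite mul1n | exfalso].
  by move: le_n; rewrite !mulSn; have := p_gt4; clear; lia.
have d4 := small _ _ g0 gd vg; have e4 := small _ _ h0 he vh.
have [d0|dp] := boolP (p %| d)%N.
  have [|->|dp] := dvd d d0; first by rewrite -deE leq_addr.
    by left.
  by exfalso; move/eqP: e4; apply; move/eqP: deE; rewrite dp eqn_add2l => /eqP.
have [e0|ep] := boolP (p %| e)%N.
  have [|->|ep] := dvd e e0; first by rewrite -deE leq_addl.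
    by right.
  by exfalso; move/eqP: d4; apply; move/eqP: deE; rewrite ep addnC eqn_add2l => /eqP.
exfalso; rewrite (dvdn_pcharf charp) in dp; rewrite (dvdn_pcharf charp) in ep.
have [gP dgP] := singular_factor charp p_gt2 p_mod3 gd vg dp.
have [hP dhP] := singular_factor charp p_gt2 p_mod3 he vh ep.
have /eqP := hessian_jouanolou_pform charp p_gt2 p_mod3; apply.
rewrite eF !(mderivM, mderivD) !(mevalM, mevalD).
by rewrite gP hP !dgP !dhP !(mul0r, mulr0, addr0).
Qed.

Lemma irreducible_jouanolou_pform : irreducible_mpoly F.
Proof.
have F0 := jouanolou_pform_neq0.
have Fh := jouanolou_pform_homog k p.
have vF := derivation_jouanolou_pform charp.
have [t t7 t1] := exists_unity7.
have t0 : t != 0 by apply: contraTneq (oner_neq0 k) => t0; rewrite -t7 t0 expr0n eqxx.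
have [c sF] := diag_act_pform t7 p.
have [g [gp [h0 eFg] [c' sg]]] :=
  @semi_inv_prime_factor k 3 jouanolou_weight 7 t F c _ isT t7 F0 Fh p_mod7 sF.
have [g0 gu gd] := gp.
have [e ge] := homog_factor F0 Fh eFg.
have e0 : (0 < e)%N by rewrite lt0n -(homog_unit g0 ge).
have [m [h [eF ngh]]] := max_power_divisor F0 Fh ge e0.
case: m eF => [|m] eF.
  by case: ngh; exists h0; rewrite -eFg eF mul1r.
have h_n0 : h != 0 by apply: contraNneq F0 => e1; rewrite eF e1 mulr0.
have [a ha] := homog_factor F0 Fh (etrans eF (mulrC _ _)).
have [pm|pm] := boolP (p %| m.+1)%N.
  have [r er] : exists r, m.+1 = (p + r)%N.
    by exists (m.+1 - p)%N; rewrite subnKC // dvdn_leq.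
  have eH : F = g ^+ p * (g ^+ r * h) by rewrite eF er exprD mulrA.
  set H := g ^+ r * h in eH; exfalso; move/eqP: (F0); apply; rewrite eH.
  suff -> : H = 0 by rewrite mulr0.
  have gp0 : g ^+ p != 0 by rewrite expf_neq0.
  have [b Hb] := homog_factor F0 Fh (etrans eH (mulrC _ _)).
  have bE : (e * p + b = p + 4)%N.
    by apply: (@homog_mulE _ _ (g ^+ p) H); rewrite -?eH //; apply: dhomogMn.
  have b4 : b = 4%N.
    (* For [e] at least 2 the degree [e * p] alone exceeds [p + 4]; so [g] is linear and [H] a
       quartic. *)
    case: (e) e0 bE => [|[|e']] // _; first by rewrite mul1n => /addnI.
    by rewrite !mulSn -!addnA => /addnI eq4; have := p_gt4; rewrite -eq4 ltnNge leq_addr.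
  rewrite b4 in Hb; apply: (quartic_first_integral two0 seven0 Hb).
  apply: (mulfI gp0); rewrite mulr0 -vF eH derivationM.
  suff -> : derivation v (g ^+ p) = 0 by rewrite mul0r add0r.
  rewrite -[X in g ^+ X](prednK (prime_gt0 p_pr)) derivationXn prednK ?prime_gt0 //.
  by rewrite -(@scaler_nat k) (pcharf0 charp) scale0r.
have vg : derivation v g = 0.
  (* Cancelling [g ^ m] in [v F = 0] leaves [(m + 1) h v(g) + g v(h) = 0], where [m + 1] is
     invertible and [g] does not divide [h]. *)
  have [l el] : divides g (derivation v g).
    have [|//|/ngh//] := gd (derivation v g) h.
    have mU : (m.+1%:R : k)%:MP \is a @GRing.unit {mpoly k[3]}.
      by rewrite (rmorph_unit (@mpolyC 3 k)) // unitfE -(dvdn_pcharf charp).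
    apply: (divides_unitM mU); exists (- derivation v h).
    apply: (mulfI (expf_neq0 m g0)); apply/eqP; rewrite -subr_eq0 -vF eF.
    by rewrite derivationM derivationXn exprS mpolyC_nat; apply/eqP; ring.
  have l1 : l \is 1.-homog.
    have [->|l0] := eqVneq l 0; first exact: rpred0.
    have vgh : derivation v g \is e.+1.-homog.
      exact: (derivation_homog (@jouanolou_field_homog k)).
    have vg0 : derivation v g != 0 by rewrite el mulf_neq0.
    have [b lb] := homog_factor vg0 vgh (etrans el (mulrC _ _)).
    suff b1 : b = 1%N by rewrite b1 in lb.
    have /eqP : (e + b = e.+1)%N by apply: (@homog_mulE _ _ g l); rewrite -?el.
    by rewrite -addn1 eqn_add2l => /eqP.
  (* Apply the action to [v g = g * l]: [g] is semi-invariant and [v] has weight [-1], so [l] has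
     weight [-1]. *)
  have : g * diag_act jouanolou_weight t l = g * (t ^+ 6 *: l).
    have cn := semi_inv_neq0 t0 g0 sg.
    apply: (mulfI (_ : c'%:MP != 0)); first by rewrite mpolyC_eq0.
    rewrite !mulrA !mul_mpolyC -sg -diag_actM -el (diag_act_derivation t7) sg.
    by rewrite derivationZ el -scalerAr -scalerAl.
  by move/(mulfI g0) => sl; rewrite el (diag_act_linear_eq0 t7 t1 l1 sl) mulr0.
pose h2 := g ^+ m * h.
have eF2 : F = g * h2 by rewrite eF exprS mulrA.
have [b hb] := homog_factor F0 Fh (etrans eF2 (mulrC _ _)).
have vh2 : derivation v h2 = 0.
  by apply: (mulfI g0); move: vF; rewrite eF2 derivationM vg mul0r add0r mulr0.
have h20 : h2 != 0 by apply: contraNneq F0 => e1; rewrite eF2 e1 mulr0.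
have [e00|b0] := first_integral_factor eF2 ge hb vg vh2; first by rewrite e00 in e0.
have h2u : h2 \is a GRing.unit by rewrite (homog_unit h20 hb) b0.
have [_ _ gI] := prime_irred gp.
split=> //; first by rewrite eF2 unitrM (negbTE gu).
move=> x y exy; have eg : g = x * (y / h2) by rewrite mulrA -exy eF2 mulrK.
by case: (gI _ _ eg) => [|yu]; [left | right; rewrite unitrM unitrV h2u andbT in yu].
Qed.

End Irreducibility.

(** The point [(1 : 1 : 1)] lies in the chart [z = 1], and dehomogenizing commutes with the
    derivative along [x], so the nonzero second derivative is still visible there. *)
Lemma dehomog_jouanolou_pform_neq0 (k : closedFieldType) (p : nat) :
  p \in [pchar k] -> (2 < p)%N -> p = 2 %[mod 3] ->
  dehomog 2%R (jouanolou_pform k p) != 0.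
Proof.
move=> charp p_gt2 p_mod3.
apply: contraNneq (hessian_jouanolou_pform charp p_gt2 p_mod3) => F0.
have := congr1 (fun f => mderiv 0 (mderiv 0 f)) F0.
rewrite !mderiv_dehomog !mderiv0 (_ : lift 2%R 0 = 0); last exact/val_inj.
move/(congr1 (meval ((\row_j 1 : 'rV[k]_2) 0))); rewrite meval_dehomog meval0 => e.
rewrite -e; apply/eqP/meval_eq => j.
by rewrite mxE; case: unlift => // l; rewrite mxE.
Qed.

Theorem theorem2 (p : nat) (k : closedFieldType) (p_prime : prime p)
    (p_gt2 : (2 < p)%N) (p_mod7 : ~~ (7 %| p + 4)%N)
    (p_mod3 : p <> 1 %[mod 3]) (char_k : p \in [pchar k]) :
  ~ p_closed p (jouanolou k 2) /\ prime_divisor (p_divisor p (jouanolou k 2)).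
Proof.
(* The prime 3 is excluded by the condition at 7, because [3 + 4 = 7]. *)
have p_neq3 : p != 3 by apply: contraNneq p_mod7 => ->.
have p_mod3' : p = 2 %[mod 3].
  have : (p %% 3)%N != 0%N by rewrite -/(3 %| p)%N dvdn_prime2 // eq_sym.
  have : (p %% 3 < 3)%N by rewrite ltn_mod.
  by move: p_mod3; case: (p %% 3)%N => [|[|[|]]].
have p_gt4 : (4 < p)%N by case: (p) p_gt2 p_neq3 p_prime => [|[|[|[|[|]]]]].
have D := p_divisor_jouanolou char_k.
split.
  move=> cl; have [c c0 e] := D 2%R.
  move/esym/eqP: e; rewrite (cl 2%R) scaler_eq0 (negbTE c0) /=; apply/negP.
  exact: dehomog_jouanolou_pform_neq0.
exists (p + 4)%N, (jouanolou_pform k p); split=> //.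
  exact: jouanolou_pform_homog.
exact: irreducible_jouanolou_pform.
Qed.
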